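(* Let $m\ge 1$, $\boldsymbol\Sigma\in\boldsymbol\Phi_m^\beta$, $\kappa=(k_1,\dots,k_m)\in\mathbb R^m$, let $\mathbf X$ be a random matrix in $\mathfrak P_m^\beta$ and let $\mathbf Y=\mathbf X^{-1}$. 1. If $\mathbf X$ has a Riesz distribution of type I with parameters $(a,\kappa,\boldsymbol\Sigma)$, $\mathrm{Re}(a)\ge (m-1)\beta/2-k_m$, then $\mathbf Y$ has density, with respect to $(d\mathbf Y)$ on $\mathfrak P_m^\beta$, $$\frac{\beta^{am+\sum_{i=1}^m k_i}}{\Gamma_m^\beta[a,\kappa]\,|\boldsymbol\Sigma|^a q_\kappa(\boldsymbol\Sigma)}\,\exp\{-\beta\,\mathrm{tr}(\boldsymbol\Sigma^{-1}\mathbf Y^{-1})\}\,|\mathbf Y|^{-(a+(m-1)\beta/2+1)}\,q_\kappa(\mathbf Y^{-1}).$$ 2. If $\mathbf X$ has a Riesz distribution of type II with parameters $(a,\kappa,\boldsymbol\Sigma)$, $\mathrm{Re}(a)>(m-1)\beta/2+k_1$, then $\mathbf Y$ has density, with respect to $(d\mathbf Y)$ on $\mathfrak P_m^\beta$, $$\frac{\beta^{am-\sum_{i=1}^m k_i}}{\Gamma_m^\beta[a,-\kappa]\,|\boldsymbol\Sigma|^a q_\kappa(\boldsymbol\Sigma^{-1})}\,\exp\{-\beta\,\mathrm{tr}(\boldsymbol\Sigma^{-1}\mathbf Y^{-1})\}\,|\mathbf Y|^{-(a+(m-1)\beta/2+1)}\,q_\kappa(\mathbf Y).$$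
   Context: Let $\mathfrak A$ be $\mathbb R$, $\mathbb C$ or the quaternions $\mathbb H$, and $\beta=\dim_{\mathbb R}\mathfrak A\in\{1,2,4\}$. $\mathbf A^*$ is the conjugate transpose. $\mathfrak S_m^\beta$ is the real vector space of Hermitian $m\times m$ matrices over $\mathfrak A$ and $\mathfrak P_m^\beta\subset\mathfrak S_m^\beta$ the open cone of positive definite ones. For Hermitian $\mathbf S$, $|\mathbf S|$ is the determinant, i.e. the product of its $m$ real eigenvalues; $\mathrm{tr}$ denotes the real part of the trace. $(d\mathbf S)$ is the Lebesgue measure $\prod_i ds_{ii}\prod_{i<j}\prod_{k=1}^\beta ds_{ij}^{(k)}$ on $\mathfrak S_m^\beta$, where $s_{ij}^{(k)}$ are the real components of $s_{ij}$. For $\kappa=(k_1,\dots,k_m)\in\mathbb R^m$ and $\mathbf S\in\mathfrak P_m^\beta$, the generalised power (highest weight vector) is $q_\kappa(\mathbf S)=|\mathbf S|^{k_m}\prod_{i=1}^{m-1}|\mathbf S_i|^{k_i-k_{i+1}}$, with $\mathbf S_i$ the leading principal $i\times i$ submatrix. $\boldsymbol\Phi_m^\beta=\mathfrak P_m^\beta+i\,\mathfrak S_m^\beta$ is the generalised right half-plane in the complexification of $\mathfrak S_m^\beta$; for $\boldsymbol\Sigma\in\boldsymbol\Phi_m^\beta$ the expressions $\boldsymbol\Sigma^{-1}$, $|\boldsymbol\Sigma|^a$, $q_\kappa(\boldsymbol\Sigma)$, $q_\kappa(\boldsymbol\Sigma^{-1})$, $\mathrm{tr}(\boldsymbol\Sigma^{-1}\mathbf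 X)$ are the holomorphic extensions in $\boldsymbol\Sigma$ of the corresponding expressions on $\mathfrak P_m^\beta$. Generalised gamma functions: $\Gamma_m^\beta[a,\kappa]=\int_{\mathfrak P_m^\beta}e^{-\mathrm{tr}\,\mathbf A}|\mathbf A|^{a-(m-1)\beta/2-1}q_\kappa(\mathbf A)(d\mathbf A)$ and $\Gamma_m^\beta[a,-\kappa]=\int_{\mathfrak P_m^\beta}e^{-\mathrm{tr}\,\mathbf A}|\mathbf A|^{a-(m-1)\beta/2-1}q_\kappa(\mathbf A^{-1})(d\mathbf A)$. $\mathbf X$ has a Riesz distribution of type I, resp. type II, with parameters $(a,\kappa,\boldsymbol\Sigma)$ if it has the following probability density on $\mathfrak P_m^\beta$ with respect to $(d\mathbf X)$ (parameters being such that this is a probability density): type I: $\dfrac{\beta^{am+\sum k_i}}{\Gamma_m^\beta[a,\kappa]|\boldsymbol\Sigma|^aq_\kappa(\boldsymbol\Sigma)}e^{-\beta\,\mathrm{tr}(\boldsymbol\Sigma^{-1}\mathbf X)}|\mathbf X|^{a-(m-1)\beta/2-1}q_\kappa(\mathbf X)$; type II: $\dfrac{\beta^{am-\sum k_i}}{\Gamma_m^\beta[a,-\kappa]|\boldsymbol\Sigma|^aq_\kappa(\boldsymbol\Sigma^{-1})}e^{-\beta\,\mathrm{tr}(\boldsymbol\Sigma^{-1}\mathbf X)}|\mathbf X|^{a-(m-1)\beta/2-1}q_\kappa(\mathbf X^{-1})$. *)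

(* Defs.v *)
From HB Require Import structures.
From mathcomp Require Import all_boot all_order all_algebra.
From mathcomp Require Import ring.
From mathcomp Require Import complex.
From mathcomp Require Import all_classical all_reals all_analysis.

Set Implicit Arguments.
Unset Strict Implicit.
Unset Printing Implicit Defensive.

Import Order.TTheory GRing.Theory Num.Theory.
Import numFieldNormedType.Exports.

Local Open Scope classical_set_scope.
Local Open Scope ring_scope.
Local Open Scope complex_scope.

Record quat (R : Type) : Type := Quat { q0 : R; q1 : R; q2 : R; q3 : R }.

Section QuatRing.
Variable R : comNzRingType.
Implicit Types x y z : quat R.

Definition quat_to_prod x : R * R * (R * R) := ((q0 x, q1 x), (q2 x, q3 x)).
Definition prod_to_quat (p : R * R * (R * R)) : quat R :=
  Quat p.1.1 p.1.2 p.2.1 p.2.2.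

Lemma quat_to_prodK : cancel quat_to_prod prod_to_quat.
Proof. by case. Qed.

HB.instance Definition _ := Choice.copy (quat R) (can_type quat_to_prodK).

Definition addq x y :=
  Quat (q0 x + q0 y) (q1 x + q1 y) (q2 x + q2 y) (q3 x + q3 y).
Definition oppq x := Quat (- q0 x) (- q1 x) (- q2 x) (- q3 x).
Definition zeroq : quat R := Quat 0 0 0 0.

Lemma addqA : associative addq.
Proof. by move=> [a b c d] [e f g h] [i j k l]; congr Quat; exact: addrA. Qed.
Lemma addqC : commutative addq.
Proof. by move=> [a b c d] [e f g h]; congr Quat; exact: addrC. Qed.
Lemma add0q : left_id zeroq addq.
Proof. by move=> [a b c d]; congr Quat; exact: add0r. Qed.
Lemma addNq : left_inverse zeroq oppq addq.
Proof. by move=> [a b c d]; congr Quat; exact: addNr. Qed.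

HB.instance Definition _ :=
  GRing.isZmodule.Build (quat R) addqA addqC add0q addNq.

Definition oneq : quat R := Quat 1 0 0 0.
Definition mulq x y := Quat
  (q0 x * q0 y - q1 x * q1 y - q2 x * q2 y - q3 x * q3 y)
  (q0 x * q1 y + q1 x * q0 y + q2 x * q3 y - q3 x * q2 y)
  (q0 x * q2 y - q1 x * q3 y + q2 x * q0 y + q3 x * q1 y)
  (q0 x * q3 y + q1 x * q2 y - q2 x * q1 y + q3 x * q0 y).

Lemma mulqA : associative mulq.
Proof. by move=> [a b c d] [e f g h] [i j k l]; congr Quat => /=; ring. Qed.
Lemma mul1q : left_id oneq mulq.
Proof. by move=> [a b c d]; congr Quat => /=; ring. Qed.
Lemma mulq1 : right_id oneq mulq.
Proof. by move=> [a b c d]; congr Quat => /=; ring. Qed.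
Lemma mulqDl : left_distributive mulq addq.
Proof. by move=> [a b c d] [e f g h] [i j k l]; congr Quat => /=; ring. Qed.
Lemma mulqDr : right_distributive mulq addq.
Proof. by move=> [a b c d] [e f g h] [i j k l]; congr Quat => /=; ring. Qed.
Lemma oneq_neq0 : oneq != zeroq.
Proof. by apply/eqP => -[] /eqP; rewrite oner_eq0. Qed.

HB.instance Definition _ := GRing.Zmodule_isNzRing.Build (quat R)
  mulqA mul1q mulq1 mulqDl mulqDr oneq_neq0.

Definition conjq x := Quat (q0 x) (- q1 x) (- q2 x) (- q3 x).

End QuatRing.

Inductive algebra_kind := RealAlg | ComplexAlg | QuaternionAlg.

Definition beta (k : algebra_kind) : nat :=
  match k with RealAlg => 1 | ComplexAlg => 2 | QuaternionAlg => 4 end.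

Definition alg (R : realType) (k : algebra_kind) : nzRingType :=
  match k with
  | RealAlg => R
  | ComplexAlg => R[i]
  | QuaternionAlg => quat R
  end.

Definition conjA (R : realType) (k : algebra_kind) : alg R k -> alg R k :=
  match k return alg R k -> alg R k with
  | RealAlg => id
  | ComplexAlg => fun z : R[i] => complex.Re z -i* complex.Im z
  | QuaternionAlg => @conjq R
  end.

Definition components (R : realType) (k : algebra_kind) : alg R k -> seq R :=
  match k return alg R k -> seq R with
  | RealAlg => fun x : R => [:: x]
  | ComplexAlg => fun z : R[i] => [:: complex.Re z; complex.Im z]
  | QuaternionAlg => fun q : quat R => [:: q0 q; q1 q; q2 q; q3 q]
  end.

Definition component (R : realType) (k : algebra_kind)
  (x : alg R k) (j : 'I_(beta k)) : R := nth 0 (components x) j.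

Definition reA (R : realType) (k : algebra_kind) (x : alg R k) : R :=
  nth 0 (components x) 0.

Definition of_components (R : realType) (k : algebra_kind) :
    ('I_(beta k) -> R) -> alg R k :=
  match k return ('I_(beta k) -> R) -> alg R k with
  | RealAlg => fun c => c (inord 0)
  | ComplexAlg => fun c => c (inord 0) +i* c (inord 1)
  | QuaternionAlg => fun c =>
      Quat (c (inord 0)) (c (inord 1)) (c (inord 2)) (c (inord 3))
  end.

Definition realA (R : realType) (k : algebra_kind) (x : R) : alg R k :=
  of_components (fun j : 'I_(beta k) => if j == 0 :> nat then x else 0).

Section Hermitian.
Variables (R : realType) (k : algebra_kind).
Local Notation A := (alg R k).

Definition ctrmx m n (M : 'M[A]_(m, n)) : 'M[A]_(n, m) :=
  \matrix_(i, j) conjA (M j i).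

Definition hermitian m (S : 'M[A]_m) : Prop := ctrmx S = S.

Definition posdef m (S : 'M[A]_m) : Prop :=
  hermitian S /\
  forall v : 'cV[A]_m, v != 0 -> 0 < reA ((ctrmx v *m S *m v) 0 0).

(* [l] lists the eigenvalues of [S] with multiplicity: the columns of the
   unitary [U] are eigenvectors, S u_j = u_j l_j. *)
Definition eigenvalues_of m (S : 'M[A]_m) (l : 'rV[R]_m) : Prop :=
  exists U : 'M[A]_m,
    [/\ ctrmx U *m U = 1%:M, U *m ctrmx U = 1%:M &
        S *m U = U *m diag_mx (map_mx (@realA R k) l)].

(* Meaningful for Hermitian [S] only; the product does not depend on the order
   in which the eigenvalues are listed. *)
Definition hdet m (S : 'M[A]_m) : R :=
  \prod_(i < m) (xget 0 [set l | eigenvalues_of S l]) 0 i.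

Definition hinv m (S : 'M[A]_m) : 'M[A]_m :=
  xget 0 [set B | S *m B = 1%:M /\ B *m S = 1%:M].

Definition retr m (S : 'M[A]_m) : R := \sum_(i < m) reA (S i i).

(* The leading principal submatrix on the rows and columns 0, ..., i. *)
Definition leading m (S : 'M[A]_m) (i : 'I_m) : 'M[A]_i.+1 :=
  mxsub (widen_ord (ltn_ord i)) (widen_ord (ltn_ord i)) S.

(* The matrices have size m = n.+1, and [kap] is indexed from 0. *)
Definition qpow n (kap : 'I_n.+1 -> R) (S : 'M[A]_n.+1) : R :=
  hdet S `^ kap ord_max *
  \prod_(i < n) hdet (leading S (widen_ord (leqnSn n) i))
                  `^ (kap (widen_ord (leqnSn n) i) - kap (lift ord0 i)).

(* One coordinate for each s_ii and one for each component of each s_ij with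
   i < j. *)
Definition hcoord m : finType :=
  ('I_m + {p : 'I_m * 'I_m | (p.1 < p.2)%N} * 'I_(beta k))%type.

Definition hdim m : nat := #|{: hcoord m}|.

Definition coord_of m (S : 'M[A]_m) (c : hcoord m) : R :=
  match c with
  | inl i => reA (S i i)
  | inr (p, j) => component (S (val p).1 (val p).2) j
  end.

Definition herm_entry m (x : hcoord m -> R) (i j : 'I_m) : A :=
  if insub (i, j) is Some p then of_components (fun l => x (inr (p, l)))
  else realA k (x (inl i)).

Definition herm_of_coord m (x : hcoord m -> R) : 'M[A]_m :=
  \matrix_(i, j) if (i <= j)%N then herm_entry x i j
                 else conjA (herm_entry x j i).

Definition coords m (S : 'M[A]_m) : (hdim m).-tuple (measurableTypeR R) :=
  [tuple coord_of S (enum_val j) | j < hdim m].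

Definition herm_of m (x : 'I_(hdim m) -> R) : 'M[A]_m :=
  herm_of_coord (fun c => x (enum_rank c)).

End Hermitian.

Section LebesgueN.
Variable R : realType.
Local Notation RT := (measurableTypeR R).

Definition tcons n (p : RT * n.-tuple RT) : n.+1.-tuple RT :=
  [the n.+1.-tuple RT of p.1 :: p.2].

Let measurable_tcons n : measurable_fun setT (@tcons n).
Proof.
by apply: measurable_cons; [exact: measurable_fst|exact: measurable_snd].
Qed.

HB.instance Definition _ n :=
  isMeasurableFun.Build _ _ _ _ (@tcons n) (@measurable_tcons n).

Section Step.
Variables (n : nat) (mu : {measure set (n.-tuple RT) -> \bar R}).

Definition lebesgueS : set (n.+1.-tuple RT) -> \bar R :=
  pushforward (@lebesgue_measure R \x^ mu)%E (@tcons n).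

Let lebesgueS0 : lebesgueS set0 = 0%E.
Proof. exact: measure0. Qed.

Let lebesgueS_ge0 A : (0 <= lebesgueS A)%E.
Proof. exact: measure_ge0. Qed.

Let lebesgueS_sigma_additive : semi_sigma_additive lebesgueS.
Proof. exact: measure_semi_sigma_additive. Qed.

HB.instance Definition _ := isMeasure.Build _ _ _ lebesgueS
  lebesgueS0 lebesgueS_ge0 lebesgueS_sigma_additive.

End Step.

Fixpoint lebesgueN n : {measure set (n.-tuple RT) -> \bar R} :=
  match n with
  | 0 => \d_([tuple] : 0.-tuple RT)
  | n'.+1 => [the measure _ _ of lebesgueS (lebesgueN n')]
  end.

End LebesgueN.

Section ComplexValued.
Variable R : realType.

Definition cexp (z : R[i]) : R[i] :=
  (expR (complex.Re z))%:C * (cos (complex.Im z) +i* sin (complex.Im z)).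

(* The principal power; used for x > 0 only. *)
Definition cpow (x : R) (s : R[i]) : R[i] := cexp (s * (ln x)%:C).

Definition holomorphic_on N (D : set 'rV[R[i]]_N) (F : 'rV[R[i]]_N -> R[i]) :
    Prop :=
  let K : numFieldType := R[i] in
  forall Z : 'rV[K]_N, D Z -> differentiable (F : 'rV[K]_N -> K^o) Z.

End ComplexValued.

Section Cone.
Variables (R : realType) (k : algebra_kind) (m : nat).
Local Notation A := (alg R k).
Local Notation C := R[i].
Local Notation dim := (hdim k m).
Local Notation coordT := (dim.-tuple (measurableTypeR R)).

Definition herm_of_tuple (x : coordT) : 'M[A]_m := herm_of (tnth x).

Definition cone : set coordT := [set x | posdef (herm_of_tuple x)].

Definition cone_integral (f : 'M[A]_m -> C) : C :=
  (\int[lebesgueN R dim]_(x in cone) complex.Re (f (herm_of_tuple x))) +i*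
  (\int[lebesgueN R dim]_(x in cone) complex.Im (f (herm_of_tuple x))).

(* The complexification of the space of Hermitian matrices is C^dim, through
   the real coordinates of Hermitian matrices. *)
Definition half_plane : set 'rV[C]_dim :=
  [set Z | posdef (herm_of (fun j => complex.Re (Z 0 j)) : 'M[A]_m)].

Definition complexify (S : 'M[A]_m) : 'rV[C]_dim :=
  \row_j (tnth (coords S) j)%:C.

(* The value at Z of the holomorphic extension to the half-plane of a function
   f on the cone. *)
Definition holo_ext (f : 'M[A]_m -> C) (Z : 'rV[C]_dim) : C :=
  xget 0 [set w | exists F : 'rV[C]_dim -> C,
    [/\ holomorphic_on half_plane F,
        forall S, posdef S -> F (complexify S) = f S & w = F Z]].

Section Density.
Variables (d : measure_display) (T : measurableType d) (P : probability T R).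

(* A probability density on the cone, although written with complex
   parameters, takes nonnegative real values; [0 <= f S] in R[i] says so. *)
Definition has_density (X : T -> 'M[A]_m) (f : 'M[A]_m -> C) : Prop :=
  [/\ measurable_fun setT (fun w => coords (X w)),
      forall S, posdef S -> 0 <= f S,
      measurable_fun cone
        (fun x => complex.Re (f (herm_of_tuple x)) : measurableTypeR R) &
      forall B : set coordT, measurable B ->
        P [set w | B (coords (X w))] =
        (\int[lebesgueN R dim]_(x in cone `&` B)
           (complex.Re (f (herm_of_tuple x)))%:E)%E].

End Density.
End Cone.

Section Riesz.
Variables (R : realType) (k : algebra_kind) (n : nat).
Local Notation A := (alg R k).
Local Notation C := R[i].
Local Notation m := n.+1.
Local Notation b := ((beta k)%:R : R).
Local Notation dim := (hdim k m).
Variables (a : C) (kap : 'I_m -> R).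

Definition half_shift : R := n%:R * b / 2.

Definition gamma_pos : C := cone_integral (fun S : 'M[A]_m =>
  (expR (- retr S))%:C * cpow (hdet S) (a - half_shift%:C - 1)
  * (qpow kap S)%:C).

Definition gamma_neg : C := cone_integral (fun S : 'M[A]_m =>
  (expR (- retr S))%:C * cpow (hdet S) (a - half_shift%:C - 1)
  * (qpow kap (hinv S))%:C).

Variable Sigma : 'rV[C]_dim.

Definition det_pow : C := holo_ext (fun S : 'M[A]_m => cpow (hdet S) a) Sigma.

Definition q_ext : C := holo_ext (fun S : 'M[A]_m => (qpow kap S)%:C) Sigma.

Definition q_inv_ext : C :=
  holo_ext (fun S : 'M[A]_m => (qpow kap (hinv S))%:C) Sigma.

Definition tr_inv_ext (X : 'M[A]_m) : C :=
  holo_ext (fun S : 'M[A]_m => (retr (hinv S *m X))%:C) Sigma.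

Definition sum_kap : C := (\sum_i kap i)%:C.

Definition riesz1_const : C :=
  cpow b (a * m%:R + sum_kap) / (gamma_pos * det_pow * q_ext).

Definition riesz2_const : C :=
  cpow b (a * m%:R - sum_kap) / (gamma_neg * det_pow * q_inv_ext).

Definition riesz1_density (X : 'M[A]_m) : C :=
  riesz1_const * cexp (- (b%:C * tr_inv_ext X))
  * cpow (hdet X) (a - half_shift%:C - 1) * (qpow kap X)%:C.

Definition riesz2_density (X : 'M[A]_m) : C :=
  riesz2_const * cexp (- (b%:C * tr_inv_ext X))
  * cpow (hdet X) (a - half_shift%:C - 1) * (qpow kap (hinv X))%:C.

Definition inv_riesz1_density (Y : 'M[A]_m) : C :=
  riesz1_const * cexp (- (b%:C * tr_inv_ext (hinv Y)))
  * cpow (hdet Y) (- (a + half_shift%:C + 1)) * (qpow kap (hinv Y))%:C.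

Definition inv_riesz2_density (Y : 'M[A]_m) : C :=
  riesz2_const * cexp (- (b%:C * tr_inv_ext (hinv Y)))
  * cpow (hdet Y) (- (a + half_shift%:C + 1)) * (qpow kap Y)%:C.

End Riesz.

(* Main.v *)
Require Import Defs.
From HB Require Import structures.
From mathcomp Require Import all_boot all_order all_algebra.
From mathcomp Require Import complex.
From mathcomp Require Import all_classical all_reals all_analysis.
From mathcomp Require Import ring lra measurable_realfun.
Set Implicit Arguments.
Unset Strict Implicit.
Unset Printing Implicit Defensive.
Import Order.TTheory GRing.Theory Num.Theory.
Import numFieldNormedType.Exports.
Local Open Scope classical_set_scope.
Local Open Scope ring_scope.

(** Inversion is an involution of the cone of positive definite m x m matrices,
    and its Jacobian at S is |S|^-((m - 1) beta + 2). If X has density f, then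
    X^-1 has at S the density f (S^-1) |S|^-((m - 1) beta + 2). For both Riesz
    densities |S^-1| = |S|^-1 merges the two powers of |S| into the exponent
    - (a + (m - 1) beta / 2 + 1), and the other factors are only evaluated at
    S^-1. So everything rests on the Jacobian (transports_inversion and
    integral_cone_inversion, used in has_density_hinv).

    The Jacobian is found without differential calculus in several variables.
    Sweeping S on the index p replaces the pivot t = s_pp by - 1/t, divides the
    rest of row and column p by t, and subtracts s_ip s_pj / t from the other
    entries; sweeping on all indices in turn gives - S^-1 (sweeps_enum). In the
    real coordinates of a hermitian matrix one sweep is a composition of maps
    that alter a single coordinate: translations, (m - 1) beta divisions by t,
    and t |-> - 1/t. By Tonelli's theorem and three substitution rules on the
    real line its Jacobian is |t|^-((m - 1) beta + 2) (transports_sweep). The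
    conventions 0^-1 = 0 and J = 0 at a null pivot make this identity true
    with no exceptional set. Multiplying over all sweeps gives the power
    - ((m - 1) beta + 2) of the product of the pivots. The pivots also decide
    positive definiteness (posdef_pivots), which makes the cone measurable.

    It remains to see that the product of the pivots is |S|, the product of the
    eigenvalues. Over the quaternions there is no determinant to compare them
    with, so both are compared with rdet, the determinant of the action of S
    on A^m = R^(m beta): rdet is multiplicative, it is the beta-th power of the
    product of the pivots because S is a product of matrices that each differ
    from the identity in one row (rdet_pivots), and it is the beta-th power of
    the product of the eigenvalues by the spectral theorem (hdet_posdef). The
    spectral theorem itself is proved for the three algebras at once, with
    Householder reflections. *)

(** * Weighted images of measures *)

Section WeightedPushforward.
Context d1 d2 (T : measurableType d1) (U : measurableType d2) (R : realType).
Variables (mu : {measure set T -> \bar R}) (phi : T -> U) (w : T -> R).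
Hypotheses (mphi : measurable_fun setT phi) (mw : measurable_fun setT w).
Hypothesis w0 : forall t, 0 <= w t.

(** The image under phi of the measure with density w. A substitution rule
    stated as an equality between such an image and a known measure has to
    be checked on a generating family of sets only. *)
Definition weighted_pushforward (A : set U) : \bar R :=
  (\int[mu]_(t in phi @^-1` A) (w t)%:E)%E.

Let wp0 : weighted_pushforward set0 = 0%E.
Proof. by rewrite /weighted_pushforward preimage_set0 integral_set0. Qed.

Let wp_ge0 A : (0 <= weighted_pushforward A)%E.
Proof. by apply: integral_ge0 => t _; rewrite lee_fin. Qed.

Let wp_sigma_additive : semi_sigma_additive weighted_pushforward.
Proof.
move=> F mF tF mUF.
have := @semi_sigma_additive_nng_induced _ _ _ mu (EFin \o w)
  ((measurable_EFinP _ _).2 mw) w0.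
move=> /(_ (fun i => phi @^-1` F i)); rewrite -preimage_bigcup; apply.
- by move=> i; rewrite -[_ @^-1` _]setTI; exact: mphi.
- apply/trivIsetP => i j _ _ ij; rewrite -preimage_setI.
  by move/trivIsetP : tF => /(_ i j I I ij) ->; rewrite preimage_set0.
- by rewrite -[_ @^-1` _]setTI; exact: mphi.
Qed.

HB.instance Definition _ := isMeasure.Build _ _ _ weighted_pushforward
  wp0 wp_ge0 wp_sigma_additive.

Lemma weighted_pushforwardU (A B : set U) : measurable A -> measurable B ->
  A `&` B = set0 ->
  weighted_pushforward (A `|` B) =
  (weighted_pushforward A + weighted_pushforward B)%E.
Proof. exact: measureU. Qed.

Import HBNNSimple.

(** Both sides are limits along simple functions, and for an indicator the
    formula is the definition. *)
Lemma integral_weighted_pushforward (f : U -> \bar R) :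
  measurable_fun setT f -> (forall u, 0 <= f u)%E ->
  (\int[weighted_pushforward]_u f u = \int[mu]_t (f (phi t) * (w t)%:E))%E.
Proof.
move=> mf f0; pose h := nnsfun_approx measurableT mf.
transitivity (limn (fun n => \int[weighted_pushforward]_u (h n u)%:E))%E.
  rewrite -monotone_convergence//.
  - apply: eq_integral => u _; apply/esym/cvg_lim => //.
    exact: cvg_nnsfun_approx.
  - by move=> n; exact/measurable_EFinP.
  - by move=> n u _; rewrite lee_fin.
  - by move=> u _ m n mn; rewrite lee_fin; exact/lefP/nd_nnsfun_approx.
transitivity (limn (fun n => \int[mu]_t ((h n (phi t))%:E * (w t)%:E)))%E; last first.
  rewrite -monotone_convergence//.
  - apply: eq_integral => t _; apply/cvg_lim => //.
    by apply: cvgeZr => //; exact: cvg_nnsfun_approx.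
  - move=> n; apply: emeasurable_funM; last exact/measurable_EFinP.
    by apply/measurable_EFinP; exact: measurableT_comp.
  - by move=> n t _; rewrite mule_ge0 ?lee_fin.
  - move=> t _ m n mn; rewrite lee_wpmul2r ?lee_fin//.
    exact/lefP/nd_nnsfun_approx.
apply/congr_lim/funext => n.
have mk r : measurable (phi @^-1` (h n @^-1` [set r])).
  by rewrite -[_ @^-1` _]setTI; exact: mphi.
under [LHS]eq_integral do rewrite fimfunE -fsumEFin//.
rewrite ge0_integral_fsum//; last 2 first.
- by move=> r; exact/measurable_EFinP/measurable_funM.
- by move=> r u _; rewrite nnfun_muleindic_ge0.
under [RHS]eq_integral => t _.
  rewrite fimfunE -fsumEFin// ge0_mule_fsuml; last first.
    by move=> r; exact: nnfun_muleindic_ge0.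
  over.
have mi r : measurable_fun setT (fun t => (\1_(h n @^-1` [set r]) (phi t) : R)%:E).
  by apply/measurable_EFinP; apply: measurableT_comp => //.
rewrite ge0_integral_fsum//; last 2 first.
- move=> r; apply: (@emeasurable_funM _ _ _ _
    (fun t => (r * \1_(h n @^-1` [set r]) (phi t))%:E) (EFin \o w)) => //;
    last exact/measurable_EFinP.
  apply/measurable_EFinP; apply: measurable_funM => //.
  exact/measurable_EFinP/mi.
- by move=> r t _; rewrite mule_ge0 ?lee_fin// -lee_fin nnfun_muleindic_ge0.
apply: eq_fsbigr => r; rewrite inE => -[u0 _ ru0].
have r0 : 0 <= r by rewrite -ru0.
rewrite integralZl_indic_nnsfun// integral_indic// setIT.
under [RHS]eq_integral do rewrite EFinM -muleA.
rewrite ge0_integralZl//; last 2 first.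
- apply: (@emeasurable_funM _ _ _ _
    (fun t => (\1_(h n @^-1` [set r]) (phi t) : R)%:E) (EFin \o w)) => //.
  exact/measurable_EFinP.
- by move=> t _; rewrite mule_ge0 ?lee_fin.
congr (_ * _)%E; rewrite /= /weighted_pushforward integral_mkcond.
apply: eq_integral => t _.
by rewrite (epatch_indic (EFin \o w)) /= muleC.
Qed.

End WeightedPushforward.

(** * One-dimensional changes of variables *)

Section LebesgueChange.
Variable R : realType.
Local Notation RT := (measurableTypeR R).
Local Notation mu := (@lebesgue_measure R).

(** Lebesgue measure is determined by its values on half-open intervals, so
    a substitution rule that holds for their indicators holds for all
    nonnegative measurable functions. In particular f may carry the
    indicator of an arbitrary measurable set, which substitution rules for
    continuous integrands exclude. *)
Lemma lebesgue_change_of_variable (phi : RT -> RT) (w : RT -> R) :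
  measurable_fun setT phi -> measurable_fun setT w -> (forall t, 0 <= w t) ->
  (forall a b : R, (a < b)%R ->
     \int[mu]_(t in phi @^-1` `]a, b]) (w t)%:E = (b - a)%:E)%E ->
  forall f : RT -> \bar R, measurable_fun setT f -> (forall t, 0 <= f t)%E ->
  (\int[mu]_t (f (phi t) * (w t)%:E) = \int[mu]_t f t)%E.
Proof.
move=> mphi mw w0 phiw f mf f0.
rewrite -(@integral_weighted_pushforward _ _ _ _ _ mu _ _ mphi mw w0)//.
apply: eq_measure_integral => A mA _; apply/esym.
apply: lebesgue_measure_unique mA => X /ocitvP[->|[[a b]/= ab ->]].
  by rewrite !measure0.
by rewrite lebesgue_measure_itv/= lte_fin ab -EFinB -phiw.
Qed.

Lemma lebesgue_integral_translation (c : R) (f : RT -> \bar R) :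
  measurable_fun setT f -> (forall t, 0 <= f t)%E ->
  (\int[mu]_t f (t + c)%R = \int[mu]_t f t)%E.
Proof.
move=> mf f0.
rewrite -[RHS](@lebesgue_change_of_variable (fun t => t + c) (cst 1))//.
- by apply: eq_integral => t _; rewrite /= mule1.
- by apply: measurable_funD.
- move=> a b ab; rewrite -[LHS]/(\int[mu]_(t in _) cst 1%E t)%E integral_cst; last first.
    by rewrite -[_ @^-1` _]setTI; apply: measurable_funD.
  rewrite mul1e (_ : _ @^-1` _ = `]a - c, b - c]%classic); last first.
    apply/seteqP; split => t /=; rewrite !in_itv/=; lra.
  rewrite /= lebesgue_measure_itv/= lte_fin ltrD2r ab -EFinB; congr EFin; ring.
Qed.

Lemma lebesgue_integral_scaling (c : R) (f : RT -> \bar R) : c != 0 ->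
  measurable_fun setT f -> (forall t, 0 <= f t)%E ->
  (\int[mu]_t (f (t * c)%R * `|c|%:E) = \int[mu]_t f t)%E.
Proof.
move=> c0 mf f0.
have mc : measurable_fun setT ( *%R^~ c : RT -> RT) by apply: measurable_funM.
apply: (@lebesgue_change_of_variable (fun t => t * c) (cst `|c|)) => //.
move=> a b ab; rewrite -[LHS]/(\int[mu]_(t in _) cst `|c|%:E t)%E.
rewrite integral_cst; last by rewrite -[_ @^-1` _]setTI; apply: mc.
have [cp|cn|] := ltgtP 0 c; last by move/eqP; rewrite eq_sym (negbTE c0).
- rewrite (_ : _ @^-1` _ = `]a / c, b / c]%classic); last first.
    by apply/seteqP; split => t /=; rewrite !in_itv/= ltr_pdivrMr// ler_pdivlMr.
  rewrite /= lebesgue_measure_itv/= lte_fin ltr_pM2r ?invr_gt0// ab -EFinB -EFinM.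
  by congr EFin; rewrite gtr0_norm//; field.
- rewrite (_ : _ @^-1` _ = `[b / c, a / c[%classic); last first.
    apply/seteqP; split => t /=; rewrite !in_itv/=.
      by rewrite ler_ndivrMr// ltr_ndivlMr// andbC.
    by rewrite ler_ndivrMr// ltr_ndivlMr// andbC.
  rewrite /= lebesgue_measure_itv/= lte_fin ltr_nM2r ?invr_lt0// ab -EFinB -EFinM.
  by congr EFin; rewrite ltr0_norm//; field.
Qed.

Lemma lebesgue_integral_opp (f : RT -> \bar R) :
  measurable_fun setT f -> (forall t, 0 <= f t)%E ->
  (\int[mu]_t f (- t)%R = \int[mu]_t f t)%E.
Proof.
move=> mf f0.
have N1 : (-1 : R) != 0 by rewrite oppr_eq0 oner_eq0.
rewrite -[RHS](lebesgue_integral_scaling N1)//.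
by apply: eq_integral => t _; rewrite normrN1 mule1 mulrN1.
Qed.

Lemma measurable_invr : measurable_fun setT (@GRing.inv R : RT -> RT).
Proof.
have -> : [set: R] = [set 0] `|` ~` [set 0] by rewrite setUv.
apply/measurable_funU => //; first exact: measurableC.
split; first exact: measurable_fun_set1.
apply: open_continuous_measurable_fun.
  by rewrite openC; exact: closed_eq.
by move=> x; rewrite inE /= => /eqP; exact: inv_continuous.
Qed.

Let w (t : RT) : R := t^-1 ^+ 2.
Let mw : measurable_fun setT w.
Proof. by apply: (@measurable_funX _ _ _ _ (@GRing.inv R)); exact: measurable_invr. Qed.
Let w0 t : 0 <= w t. Proof. exact: sqr_ge0. Qed.

Local Notation nu := (weighted_pushforward mu (@GRing.inv R : RT -> RT) w).

(** The only interval that needs calculus: its preimage under inversion is a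
    half-line, on which t^-2 has the primitive -1/t. The other intervals
    follow from it by additivity and by the symmetry t |-> -t. *)
Let nu0b (b : R) : 0 < b -> nu `]0, b] = b%:E.
Proof.
move=> b0; rewrite /weighted_pushforward.
have -> : GRing.inv @^-1` `]0, b] = `[b^-1, +oo[%classic :> set RT.
  apply/seteqP; split => t /=; rewrite !in_itv/= andbT invr_gt0.
    by move=> /andP[t0]; rewrite invf_ple ?posrE.
  move=> bt; have t0 : 0 < t by apply: lt_le_trans bt; rewrite invr_gt0.
  by rewrite t0 invf_ple ?posrE.
have bV0 : 0 < b^-1 by rewrite invr_gt0.
rewrite (@ge0_continuous_FTC2y _ _ (fun t => - t^-1) _ 0)//.
- by rewrite invrK -EFinB sub0r opprK.
- apply: continuous_in_subspaceT => t; rewrite inE/= in_itv/= andbT => bt.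
  have t0 : t != 0 by rewrite gt_eqF// (lt_le_trans bV0).
  apply: (@continuous_comp _ _ _ (@GRing.inv R) (fun x => x ^+ 2)).
    exact: inv_continuous.
  exact: exprn_continuous.
- rewrite -oppr0; apply: cvgN; apply/gtr0_cvgV0 => //.
  by near=> t; near: t; exact: nbhs_pinfty_gt.
- move=> t bt; have t0 : t != 0 by rewrite gt_eqF// (lt_trans bV0).
  by apply: derivableN; apply: derivableV.
- apply: cvgN; apply: cvg_at_right_filter.
  by apply: inv_continuous; rewrite gt_eqF.
- move=> t; rewrite in_itv/= andbT => bt.
  have t0 : t != 0 by rewrite gt_eqF// (lt_trans bV0).
  rewrite derive1E deriveN; last exact: derivableV.
  by rewrite deriveV// derive_id scaleNr opprK scaler1 /w exprVn.
Unshelve. all: by end_near. Qed.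

Let nuU (A B : set RT) : measurable A -> measurable B -> A `&` B = set0 ->
  nu (A `|` B) = (nu A + nu B)%E.
Proof. exact: weighted_pushforwardU measurable_invr mw w0 A B. Qed.

Let nu1 (c : R) : nu [set c] = 0%E.
Proof.
rewrite /weighted_pushforward (_ : _ @^-1` _ = [set c^-1]) ?integral_set1//.
apply/seteqP; split => t /= tc; first by rewrite -tc invrK.
by rewrite tc invrK.
Qed.

Let nuN (A : set RT) : measurable A -> nu (-%R @^-1` A) = nu A.
Proof.
move=> mA; rewrite /weighted_pushforward [LHS]integral_mkcond [RHS]integral_mkcond.
have mVA : measurable (@GRing.inv R @^-1` A : set RT).
  by rewrite -[_ @^-1` _]setTI; exact: measurable_invr.
rewrite -[RHS]lebesgue_integral_opp; last 2 first.
- by apply/(measurable_restrictT _ mVA)/measurable_funTS/measurable_EFinP.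
- by move=> t; apply: erestrict_ge0 => ? _; rewrite lee_fin.
apply: eq_integral => t _; rewrite !patchE /w invrN sqrrN.
congr (if _ then _ else _).
by apply/idP/idP; rewrite !inE /= invrN.
Qed.

Let nu0ab (a b : R) : 0 <= a -> a < b -> nu `]a, b] = (b - a)%:E.
Proof.
rewrite le_eqVlt => /predU1P[<- b0|a0 ab]; first by rewrite nu0b// subr0.
have := nu0b (lt_trans a0 ab).
rewrite (_ : `]0, b]%classic = `]0, a] `|` `]a, b])%classic; last first.
  apply/seteqP; split => t /=; rewrite !in_itv/=.
    by move=> /andP[t0 tb]; case: (leP t a) => ta; [left|right]; apply/andP.
  by move=> [/andP[]|/andP[]]; lra.
rewrite nuU//; last first.
  by rewrite -subset0 => t /=; rewrite !in_itv/= => -[/andP[_]]; case: leP.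
rewrite nu0b//.
case: (nu `]a, b]) => [r| |]//=.
by rewrite -EFinD => -[<-]; rewrite addrC addKr.
Qed.

Let nuab0 (a b : R) : a < b -> b <= 0 -> nu `]a, b] = (b - a)%:E.
Proof.
move=> ab b0; rewrite -nuN//.
have -> : -%R @^-1` `]a, b] = `[- b, - a[%classic :> set RT.
  by apply/seteqP; split => t /=; rewrite !in_itv/= lerNl ltrNr andbC.
have bNa : - b < - a by rewrite ltrN2.
have E : nu ([set - b] `|` `](- b), (- a)]%classic)
       = nu (`[(- b), (- a)[%classic `|` [set - a]).
  congr nu; apply/seteqP; split => t /=; rewrite !in_itv/=.
    move=> [->|/andP[bt]]; first by left; rewrite lexx.
    by rewrite le_eqVlt => /predU1P[->|ta]; [right|left; rewrite (ltW bt)].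
  move=> [/andP[]|->]; last by right; rewrite bNa /=.
  by rewrite le_eqVlt => /predU1P[->|bt ta]; [left|right; rewrite bt ltW].
move: E; rewrite !nuU//; first last.
- by rewrite -subset0 => t /=; rewrite in_itv/= => -[-> /andP[]]; rewrite ltxx.
- by rewrite -subset0 => t /=; rewrite in_itv/= => -[/andP[_ +] tE]; rewrite tE ltxx.
rewrite !nu1 add0e adde0 => <-.
by rewrite nu0ab ?oppr_ge0//; congr EFin; ring.
Qed.

(** An interval is cut at 0, where inversion is discontinuous. By the
    convention 0^-1 = 0 the weight vanishes at t = 0, so the formula needs
    no exceptional point. *)
Lemma lebesgue_integral_oppV (f : RT -> \bar R) :
  measurable_fun setT f -> (forall t, 0 <= f t)%E ->
  (\int[mu]_t (f (- t^-1)%R * (t^-1 ^+ 2)%:E) = \int[mu]_t f t)%E.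
Proof.
move=> mf f0; rewrite -[RHS]lebesgue_integral_opp//.
apply: (lebesgue_change_of_variable measurable_invr mw w0); last 2 first.
- exact: measurableT_comp.
- by [].
move=> a b ab; rewrite -/(nu _).
have [a0|a0] := leP 0 a; first exact: nu0ab.
have [b0|b0] := leP b 0; first exact: nuab0.
rewrite (_ : `]a, b]%classic = `]a, 0] `|` `]0, b])%classic; last first.
  apply/seteqP; split => t /=; rewrite !in_itv/=.
    by move=> /andP[at_ tb]; case: (leP t 0) => ta; [left|right]; apply/andP.
  by move=> [/andP[]|/andP[]]; lra.
rewrite nuU//; last first.
  by rewrite -subset0 => t /=; rewrite !in_itv/= => -[/andP[_]]; case: leP.
by rewrite (nuab0 a0)// (nu0ab (lexx 0))// -EFinD; congr EFin; ring.
Qed.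

End LebesgueChange.

(** * Lebesgue measure on tuples *)

Section LebesgueTuple.
Variable R : realType.
Local Notation RT := (measurableTypeR R).
Local Notation mu := (@lebesgue_measure R).

Lemma measurable_tcons n : measurable_fun setT (@tcons R n).
Proof. by apply: measurable_cons => //. Qed.

(** Tonelli's theorem requires it; products of the sets that exhaust the
    factors exhaust the product. *)
Lemma lebesgueN_sigma_finite n : sigma_finite setT (lebesgueN R n).
Proof.
elim: n => [|n IHn].
  by apply: fin_num_fun_sigma_finite => //=; rewrite measure0.
have [F [FT ndF mF]] := (sigma_finiteP setT (lebesgueN R n)).1 IHn.
have /sigma_finiteP[G [GT ndG mG]] := sigma_finiteT mu.
pose H k : set (n.+1.-tuple RT) :=
  [set x | G k (thead x) /\ F k [tuple of behead x]].
have HE k : @tcons R n @^-1` H k = G k `*` F k.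
  apply/funext => -[t y]; rewrite /H /preimage /setX /mkset.
  have -> : [tuple of behead (tcons (t, y))] = y :> n.-tuple RT by exact/val_inj.
  by [].
exists H; last first.
  move=> k; have [mFk Fk] := mF k; have [mGk Gk] := mG k; split.
    apply: measurableI.
      by rewrite -[X in measurable X]setTI; apply: measurable_tnth.
    by rewrite -[X in measurable X]setTI; apply: measurable_behead.
  rewrite /= /lebesgueS /pushforward HE product_measure2E//.
  by rewrite lte_mul_pinfty// ge0_fin_numE.
apply/seteqP; split => // x _.
have : (\bigcup_i G i) (thead x) by rewrite -GT.
have : (\bigcup_i F i) [tuple of behead x] by rewrite -FT.
move=> [i _ Fi] [j _ Gj]; exists (maxn i j) => //; split.
  by move: Gj; apply/subsetPset/ndG; exact: leq_maxr.
by move: Fi; apply/subsetPset/ndF; exact: leq_maxl.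
Qed.

Section Step.
Variables (n : nat) (lam : {measure set (n.-tuple RT) -> \bar R}).
Hypothesis lam_sigma_finite : sigma_finite setT lam.

Lemma integral_lebesgueS (F : n.+1.-tuple RT -> \bar R) :
  measurable_fun setT F -> (forall x, 0 <= F x)%E ->
  (\int[lebesgueS lam]_x F x = \int[mu]_t \int[lam]_y F (tcons (t, y)))%E /\
  (\int[lebesgueS lam]_x F x = \int[lam]_y \int[mu]_t F (tcons (t, y)))%E.
Proof.
move=> mF F0.
have mt := @measurable_tcons n.
have mFt : measurable_fun setT (F \o @tcons R n) by exact: measurableT_comp.
pose H2 := isSFinite.Build _ _ _ _ (sfinite_measure_sigma_finite lam_sigma_finite).
pose H3 := isSigmaFinite.Build _ _ _ _ lam_sigma_finite.
pose lam' : {sigma_finite_measure set _ -> \bar R} := HB.pack (Measure.sort lam) H2 H3.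
have -> : (\int[lebesgueS lam]_x F x = \int[mu \x lam']_p F (tcons p))%E.
  rewrite (ge0_integral_pushforward mt)//.
  rewrite preimage_setT; apply: eq_measure_integral => A mA _.
  apply/esym; apply: (@product_measure_unique _ _ _ _ _ mu lam') => //.
  by move=> B C mB mC; exact: product_measure2E.
split.
  exact: (fubini_tonelli1 (m2 := lam') _ mFt (fun p => F0 (tcons p))).
exact: (fubini_tonelli2 (m2 := lam') _ mFt (fun p => F0 (tcons p))).
Qed.

End Step.

Definition set_coord n (x : n.-tuple RT) (i : 'I_n) (t : RT) : n.-tuple RT :=
  [tuple if j == i then t else tnth x j | j < n].

(** By Tonelli's theorem any chosen coordinate can be integrated first. All
    changes of variables below alter one coordinate at a time, so this lemma
    reduces them to one-dimensional ones. *)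
Lemma eq_integral_coord n (i : 'I_n) (F G : n.-tuple RT -> \bar R) :
  measurable_fun setT F -> measurable_fun setT G ->
  (forall x, 0 <= F x)%E -> (forall x, 0 <= G x)%E ->
  (forall x, \int[mu]_t F (set_coord x i t) =
             \int[mu]_t G (set_coord x i t))%E ->
  (\int[lebesgueN R n]_x F x = \int[lebesgueN R n]_x G x)%E.
Proof.
elim: n => [|n IHn] in i F G *; first by case: i.
move=> mF mG F0 G0 FG.
have sf := @lebesgueN_sigma_finite n.
rewrite /=; case: (unliftP ord0 i) FG => [j ij|->] FG.
- rewrite (integral_lebesgueS sf mF F0).1 (integral_lebesgueS sf mG G0).1.
  apply: eq_integral => t _; apply: (IHn j) => //.
  + apply: (measurableT_comp mF).
    by apply: (measurableT_comp (@measurable_tcons n)); exact: measurable_pair1.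
  + apply: (measurableT_comp mG).
    by apply: (measurableT_comp (@measurable_tcons n)); exact: measurable_pair1.
  + move=> y.
    have E s : tcons (t, set_coord y j s) = set_coord (tcons (t, y)) i s.
      apply/eq_from_tnth => l; rewrite tnth_mktuple ij.
      case: (unliftP ord0 l) => [l' ->|->].
        by rewrite (inj_eq lift_inj) !tnthS !tnth_mktuple.
      by rewrite !tnth0.
    by under eq_integral do rewrite E; under [RHS]eq_integral do rewrite E.
- rewrite (integral_lebesgueS sf mF F0).2 (integral_lebesgueS sf mG G0).2.
  apply: eq_integral => y _.
  have E s : tcons (s, y) = set_coord (tcons (0, y)) ord0 s.
    apply/eq_from_tnth => l; rewrite tnth_mktuple.
    by case: (unliftP ord0 l) => [l' ->|->]; rewrite ?tnthS ?tnth0.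
  by under eq_integral do rewrite E; under [RHS]eq_integral do rewrite E.
Qed.

End LebesgueTuple.

(** * Transport of Lebesgue measure *)

Section Transport.
Variables (R : realType) (n : nat).
Local Notation RT := (measurableTypeR R).
Local Notation mu := (@lebesgue_measure R).
Local Notation coordT := (n.-tuple RT).
Implicit Types (x y : coordT) (i j : 'I_n) (J K : coordT -> R).

(** The change of variables formula taken as a definition: for an injective
    smooth Phi it says that J is the absolute value of the Jacobian
    determinant. Stated without derivatives, it leaves Phi free where J
    vanishes, which takes care of the null set where a pivot is 0. *)
Definition transports (Phi : coordT -> coordT) J : Prop :=
  [/\ measurable_fun setT Phi, measurable_fun setT J, forall x, 0 <= J x &
   forall F : coordT -> \bar R, measurable_fun setT F -> (forall x, 0 <= F x)%E ->
   (\int[lebesgueN R n]_x (F (Phi x) * (J x)%:E) = \int[lebesgueN R n]_x F x)%E].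

Lemma transports_id : transports id (cst 1).
Proof.
by split => // F mF F0; apply: eq_integral => x _; rewrite mule1.
Qed.

(** The chain rule for Jacobians. *)
Lemma transports_comp Phi J Psi K : transports Phi J -> transports Psi K ->
  transports (Psi \o Phi) (fun x => K (Phi x) * J x).
Proof.
move=> [mPhi mJ J0 PhiJ] [mPsi mK K0 PsiK]; split.
- exact: measurableT_comp.
- by apply: measurable_funM => //; exact: measurableT_comp.
- by move=> x; rewrite mulr_ge0.
move=> F mF F0; rewrite -[RHS]PsiK// -[RHS](PhiJ (fun y => F (Psi y) * (K y)%:E)%E).
- by apply: eq_integral => x _; rewrite /= EFinM muleA.
- apply: emeasurable_funM; last exact/measurable_EFinP.
  exact: measurableT_comp.
- by move=> x; rewrite mule_ge0 ?lee_fin.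
Qed.

(** Values of Phi at the zeros of J do not contribute to the integrals. *)
Lemma transports_eq Phi Psi J : transports Phi J -> measurable_fun setT Psi ->
  (forall x, J x != 0 -> Phi x = Psi x) -> transports Psi J.
Proof.
move=> [mPhi mJ J0 PhiJ] mPsi PhiPsi; split => // F mF F0.
rewrite -[RHS]PhiJ//; apply: eq_integral => x _.
by have [->|/PhiPsi ->//] := eqVneq (J x) 0; rewrite !mule0.
Qed.

Lemma tnth_set_coord x i j (t : RT) :
  tnth (set_coord x i t) j = if j == i then t else tnth x j.
Proof. by rewrite tnth_mktuple. Qed.

Lemma set_coordK x i (s t : RT) : set_coord (set_coord x i s) i t = set_coord x i t.
Proof.
by apply/eq_from_tnth => j; rewrite !tnth_set_coord; case: eqP.
Qed.

Lemma measurable_set_coord x i : measurable_fun setT (set_coord x i).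
Proof.
apply/measurable_fun_tnthP => j; rewrite (_ : _ \o _ =
  fun t => if j == i then t else tnth x j); first by case: (j == i).
by apply/funext => t /=; rewrite tnth_set_coord.
Qed.

Lemma transports_coord i (phi : coordT -> RT) J :
  measurable_fun setT phi -> measurable_fun setT J -> (forall x, 0 <= J x) ->
  (forall x (f : RT -> \bar R), measurable_fun setT f -> (forall t, 0 <= f t)%E ->
    (\int[mu]_t (f (phi (set_coord x i t)) * (J (set_coord x i t))%:E) =
     \int[mu]_t f t)%E) ->
  transports (fun x => set_coord x i (phi x)) J.
Proof.
move=> mphi mJ J0 phiJ.
have mPhi : measurable_fun setT (fun x => set_coord x i (phi x)).
  apply/measurable_fun_tnthP => j; rewrite (_ : _ \o _ =
    fun x => if j == i then phi x else tnth x j); last first.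
    by apply/funext => t /=; rewrite tnth_set_coord.
  by case: (j == i) => //; exact: measurable_tnth.
split => // F mF F0; apply: (@eq_integral_coord _ _ i) => //.
- apply: emeasurable_funM; last exact/measurable_EFinP.
  exact: measurableT_comp.
- by move=> x; rewrite mule_ge0 ?lee_fin.
move=> x.
rewrite -(phiJ x (fun t => F (set_coord x i t))) => [| |t]; last exact: F0.
  by apply: eq_integral => t _; rewrite set_coordK.
by apply: (measurableT_comp mF); exact: measurable_set_coord.
Qed.

Lemma transports_shift i (g : coordT -> R) : measurable_fun setT g ->
  (forall x t, g (set_coord x i t) = g x) ->
  transports (fun x => set_coord x i (tnth x i + g x)) (cst 1).
Proof.
move=> mg gi; apply: transports_coord => //.
- by apply: measurable_funD => //; exact: measurable_tnth.
- move=> x f mf f0; rewrite -[RHS](lebesgue_integral_translation (g x))//.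
  by apply: eq_integral => t _; rewrite tnth_set_coord eqxx gi mule1.
Qed.

Lemma transports_scale i (s : coordT -> R) : measurable_fun setT s ->
  (forall x, s x != 0) -> (forall x t, s (set_coord x i t) = s x) ->
  transports (fun x => set_coord x i (tnth x i * s x)) (fun x => `|s x|).
Proof.
move=> ms s0 si; apply: transports_coord => //.
- by apply: measurable_funM => //; exact: measurable_tnth.
- exact: measurableT_comp.
- move=> x f mf f0; rewrite -[RHS](lebesgue_integral_scaling (s0 x))//.
  by apply: eq_integral => t _; rewrite tnth_set_coord eqxx si.
Qed.

Lemma transports_oppV i :
  transports (fun x => set_coord x i (- (tnth x i)^-1))
             (fun x => (tnth x i)^-1 ^+ 2).
Proof.
have mV : measurable_fun setT (fun x : coordT => (tnth x i)^-1 : RT).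
  by apply: (measurableT_comp (@measurable_invr R)); exact: measurable_tnth.
apply: transports_coord.
- exact: measurableT_comp mV.
- exact: measurable_funX.
- by move=> x; exact: sqr_ge0.
- move=> x f mf f0; rewrite -[RHS]lebesgue_integral_oppV//.
  by apply: eq_integral => t _; rewrite tnth_set_coord eqxx.
Qed.

Definition update_on (l : seq 'I_n) (phi : 'I_n -> coordT -> RT) x : coordT :=
  [tuple if j \in l then phi j x else tnth x j | j < n].

(** Performing the updates one after the other gives the same map as
    performing them together, because the new value of coordinate j reads
    only coordinate j itself and coordinates outside l, which are left
    alone. *)
Lemma transports_update_on (l : seq 'I_n) (phi : 'I_n -> coordT -> RT) K :
  uniq l ->
  (forall j, j \in l -> transports (fun x => set_coord x j (phi j x)) K) ->
  (forall j x y, j \in l ->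
     (forall i, (i \notin l) || (i == j) -> tnth x i = tnth y i) ->
     phi j x = phi j y) ->
  (forall x y, (forall i, i \notin l -> tnth x i = tnth y i) -> K x = K y) ->
  transports (update_on l phi) (fun x => K x ^+ size l).
Proof.
move=> ul phiK phil Kl.
suff H l' : uniq l' -> {subset l' <= l} ->
    transports (update_on l' phi) (fun x => K x ^+ size l').
  exact: H.
elim: l' => [_ _|c l' IH /= /andP[cl' ul'] l'l].
  rewrite (_ : update_on [::] phi = id); first exact: transports_id.
  by apply/funext => x; apply/eq_from_tnth => j; rewrite tnth_mktuple.
have cl : c \in l by apply: l'l; rewrite mem_head.
have l'l' : {subset l' <= l} by move=> j jl'; apply: l'l; rewrite in_cons jl' orbT.
have := transports_comp (IH ul' l'l') (phiK c cl).
have E x i : i \notin l -> tnth (update_on l' phi x) i = tnth x i.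
  by move=> il; rewrite tnth_mktuple ifN//; apply: contra il => /l'l'.
rewrite (_ : _ \o _ = update_on (c :: l') phi); last first.
  apply/funext => x /=; apply/eq_from_tnth => j.
  rewrite tnth_set_coord [RHS]tnth_mktuple in_cons.
  have [->|jc] := eqVneq j c; last by rewrite tnth_mktuple.
  apply: phil => // i /orP[/E//|/eqP ->].
  by rewrite tnth_mktuple (negbTE cl').
rewrite (_ : (fun x => K _ * _) = (fun x => K x ^+ (size l').+1))//.
by apply/funext => x; rewrite exprS; congr (_ * _); apply: Kl => i /E.
Qed.

End Transport.

(** * The three algebras *)

Section AlgebraFacts.
Variables (R : realType) (k : algebra_kind).
Local Notation A := (alg R k).
Local Notation conj := (@conjA R k).
Local Notation re := (@reA R k).
Local Notation real := (@realA R k).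
Implicit Types (x y : A) (r s : R) (j : 'I_(beta k)).

Lemma beta_gt0 : (0 < beta k)%N. Proof. by case: k. Qed.

Lemma component_inj x y : (forall j, component x j = component y j) -> x = y.
Proof.
case: k x y => /=.
- by move=> x y /(_ ord0).
- move=> [a b] [c d] E.
  have := E (Ordinal (isT : (0 < 2)%N)); have := E (Ordinal (isT : (1 < 2)%N)).
  by rewrite /component /= => -> ->.
- move=> [a b c d] [a' b' c' d'] E.
  have := E (Ordinal (isT : (0 < 4)%N)); have := E (Ordinal (isT : (1 < 4)%N)).
  have := E (Ordinal (isT : (2 < 4)%N)); have := E (Ordinal (isT : (3 < 4)%N)).
  by rewrite /component /= => -> -> -> ->.
Qed.

Lemma components_of (c : 'I_(beta k) -> R) j :
  component (of_components c) j = c j.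
Proof.
rewrite /component; case: k c j => /= c [[|[|[|[|//]]]] jk] //=;
  by congr c; apply/val_inj; rewrite /= inordK.
Qed.

Lemma componentD x y j : component (x + y) j = component x j + component y j.
Proof.
rewrite /component.
by case: k x y j => [x y|[a b] [c d]|[a b c d] [a' b' c' d']]
  [[|[|[|[|//]]]] jk].
Qed.

Lemma componentN x j : component (- x) j = - component x j.
Proof.
rewrite /component; case: k x j => [x|[a b]|[a b c d]] [[|[|[|[|//]]]] jk] //=.
Qed.

Lemma component_real_mul r x j : component (real r * x) j = r * component x j.
Proof.
rewrite /component /realA; case: k x j => [x|[a b]|[a b c d]] [[|[|[|[|//]]]] jk] //=;
 rewrite ?inordK//=; ring.
Qed.

Lemma realA0 : real 0 = 0.
Proof.
apply: component_inj => j; rewrite components_of if_same /component.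
by case: k j => //= -[[|[|[|[|]]]]].
Qed.

Lemma realA1 : real 1 = 1.
Proof.
by rewrite /realA; case: k => //=; rewrite ?inordK.
Qed.

Lemma realA_comm r x : real r * x = x * real r.
Proof.
rewrite /realA; case: k x => [x|[a b]|[a b c d]] /=; rewrite ?inordK//.
- exact: mulrC.
- exact: mulrC.
- by congr Quat => /=; ring.
Qed.

Lemma realAD r s : real (r + s) = real r + real s.
Proof.
apply: component_inj => j; rewrite componentD !components_of.
by case: ifP; rewrite ?addr0.
Qed.

Lemma realAN r : real (- r) = - real r.
Proof.
apply: component_inj => j; rewrite componentN !components_of.
by case: ifP; rewrite ?oppr0.
Qed.

Lemma realAM r s : real (r * s) = real r * real s.
Proof.
apply: component_inj => j; rewrite component_real_mul !components_of.
by case: ifP; rewrite ?mulr0.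
Qed.

Lemma conjAD x y : conj (x + y) = conj x + conj y.
Proof.
case: k x y => //= [[a b] [c d]|[a b c d] [a' b' c' d']] /=.
  by congr Complex; rewrite opprD.
by congr Quat; rewrite /= ?opprD.
Qed.

Lemma conjAN x : conj (- x) = - conj x.
Proof. by case: k x => //= -[]. Qed.

Lemma conjA0 : conj 0 = 0.
Proof. by rewrite -(addrN 0) conjAD conjAN subrr addrN. Qed.

Lemma conjAM x y : conj (x * y) = conj y * conj x.
Proof.
case: k x y => /= [x y|[a b] [c d]|[a b c d] [a' b' c' d']] /=.
- exact: mulrC.
- by congr Complex; rewrite /=; ring.
- by congr Quat; rewrite /=; ring.
Qed.

Lemma conjAK : involutive conj.
Proof. by case: k => [x|[a b]|[a b c d]] //=; rewrite /conjq ?opprK. Qed.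

Lemma conj_realA r : conj (real r) = real r.
Proof.
by rewrite /realA; case: k => //=; rewrite ?inordK// /conjq /= oppr0.
Qed.

Lemma reAD x y : re (x + y) = re x + re y.
Proof. by case: k x y => //= -[a b] []. Qed.

Lemma reAN x : re (- x) = - re x.
Proof. by case: k x => //= -[]. Qed.

Lemma reA0 : re 0 = 0.
Proof. by case: k. Qed.

Lemma reA_real r : re (real r) = r.
Proof. by rewrite /realA; case: k => //=; rewrite ?inordK. Qed.

Lemma reA_realM r x : re (real r * x) = r * re x.
Proof.
by rewrite /realA; case: k x => [x|[a b]|[a b c d]] //=; rewrite /reA /= ?inordK//=; ring.
Qed.

Lemma reA_conj x : re (conj x) = re x.
Proof. by case: k x => //= -[]. Qed.

(** The involution changes the sign of every component except the first. *)
Lemma self_adjoint_realA x : conj x = x -> x = real (re x).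
Proof.
move=> xE; apply: component_inj => j; rewrite components_of.
have := congr1 (fun z => component z j) xE; rewrite /component /reA.
case: k x j {xE} => [x|[a b]|[a b c d]] [[|[|[|[|//]]]] jk] //=; lra.
Qed.

Definition normA2 x : R := re (conj x * x).

Lemma conj_mulA x : conj x * x = real (normA2 x).
Proof.
by apply: self_adjoint_realA; rewrite conjAM conjAK.
Qed.

Lemma normA2E x : normA2 x = \sum_(c <- components x) c ^+ 2.
Proof.
rewrite /normA2; case: k x => [x|[a b]|[a b c d]] //=;
 rewrite /reA !big_cons big_nil /=; ring.
Qed.

Lemma normA2_ge0 x : 0 <= normA2 x.
Proof. by rewrite normA2E; apply: sumr_ge0 => c _; exact: sqr_ge0. Qed.

Lemma normA2_eq0 x : (normA2 x == 0) = (x == 0).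
Proof.
apply/eqP/eqP => [|->]; last by rewrite /normA2 mulr0 reA0.
rewrite normA2E => /eqP; rewrite big_seq psumr_eq0 => [|c _]; last exact: sqr_ge0.
move/allP => x0; apply: component_inj => j.
have cx : component x j \in components x.
  by rewrite mem_nth//; case: k x j {x0} => [x|[a b]|[a b c d]] [].
have := x0 _ cx; rewrite cx /= sqrf_eq0 => /eqP ->.
by rewrite -realA0 components_of; case: ifP.
Qed.

End AlgebraFacts.

(** * Hermitian forms and the real determinant *)

Section HermitianMatrices.
Variables (R : realType) (k : algebra_kind).
Local Notation A := (alg R k).
Local Notation real := (@realA R k).

Lemma ctrmxE m n (M : 'M[A]_(m, n)) i j : ctrmx M i j = conjA (M j i).
Proof. by rewrite mxE. Qed.

Lemma conjA_sum (I : Type) (r : seq I) (P : pred I) (F : I -> A) :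
  conjA (\sum_(i <- r | P i) F i) = \sum_(i <- r | P i) conjA (F i).
Proof. exact: (big_morph _ (@conjAD R k) (@conjA0 R k)). Qed.

Lemma reA_sum (I : Type) (r : seq I) (P : pred I) (F : I -> A) :
  reA (\sum_(i <- r | P i) F i) = \sum_(i <- r | P i) reA (F i).
Proof. exact: (big_morph _ (@reAD R k) (@reA0 R k)). Qed.

Lemma ctrmx_mul m n p (M : 'M[A]_(m, n)) (N : 'M[A]_(n, p)) :
  ctrmx (M *m N) = ctrmx N *m ctrmx M.
Proof.
apply/matrixP => i j; rewrite !mxE conjA_sum.
by apply: eq_bigr => l _; rewrite conjAM !mxE.
Qed.

Lemma ctrmxK m n (M : 'M[A]_(m, n)) : ctrmx (ctrmx M) = M.
Proof. by apply/matrixP => i j; rewrite !mxE conjAK. Qed.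

Lemma ctrmxD m n (M N : 'M[A]_(m, n)) : ctrmx (M + N) = ctrmx M + ctrmx N.
Proof. by apply/matrixP => i j; rewrite !mxE conjAD. Qed.

Lemma ctrmxN m n (M : 'M[A]_(m, n)) : ctrmx (- M) = - ctrmx M.
Proof. by apply/matrixP => i j; rewrite !mxE conjAN. Qed.

Lemma conjA1 : conjA (1 : A) = 1.
Proof. by rewrite -(realA1 R k) conj_realA. Qed.

Lemma ctrmx1 m : ctrmx (1%:M : 'M[A]_m) = 1%:M.
Proof.
apply/matrixP => i j; rewrite !mxE eq_sym; case: eqP => _.
  exact: conjA1.
exact: conjA0.
Qed.

Lemma ctrmxZ m n r (M : 'M[A]_(m, n)) :
  ctrmx (real r *: M) = real r *: ctrmx M.
Proof.
by apply/matrixP => i j; rewrite !mxE conjAM conj_realA realA_comm.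
Qed.

Lemma scalerealAr m n p r (M : 'M[A]_(m, n)) (N : 'M[A]_(n, p)) :
  M *m (real r *: N) = real r *: (M *m N).
Proof.
apply/matrixP => i j; rewrite !mxE mulr_sumr; apply: eq_bigr => l _.
by rewrite !mxE mulrA -realA_comm -mulrA.
Qed.

(** Only the real part of the hermitian form is kept: this makes A^m a
    Euclidean space of dimension m * beta, whatever the algebra. *)
Definition inner m (u v : 'cV[A]_m) : R := reA ((ctrmx u *m v) 0 0).

Lemma innerC m (u v : 'cV[A]_m) : inner u v = inner v u.
Proof.
by rewrite /inner -reA_conj -ctrmxE ctrmx_mul ctrmxK.
Qed.

Lemma innerDr m (u v w : 'cV[A]_m) : inner u (v + w) = inner u v + inner u w.
Proof. by rewrite /inner mulmxDr mxE reAD. Qed.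

Lemma innerZr m r (u v : 'cV[A]_m) : inner u (real r *: v) = r * inner u v.
Proof. by rewrite /inner scalerealAr mxE reA_realM. Qed.

Lemma inner_herm m (M : 'M[A]_m) (u v : 'cV[A]_m) : Defs.hermitian M ->
  inner u (M *m v) = inner (M *m u) v.
Proof. by move=> hM; rewrite /inner ctrmx_mul hM mulmxA. Qed.

Lemma innerE m (u : 'cV[A]_m) : inner u u = \sum_i normA2 (u i 0).
Proof. by rewrite /inner mxE reA_sum; apply: eq_bigr => i _; rewrite mxE. Qed.

Lemma inner_ge0 m (u : 'cV[A]_m) : 0 <= inner u u.
Proof. by rewrite innerE; apply: sumr_ge0 => i _; exact: normA2_ge0. Qed.

Lemma inner_eq0 m (u : 'cV[A]_m) : (inner u u == 0) = (u == 0).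
Proof.
apply/idP/eqP => [|->]; last by rewrite /inner mulmx0 mxE reA0.
rewrite innerE psumr_eq0 => [/allP u0|i _]; last exact: normA2_ge0.
apply/matrixP => i j; rewrite ord1 mxE; apply/eqP.
by rewrite -normA2_eq0; apply: u0; rewrite mem_index_enum.
Qed.

Lemma inner_gt0 m (u : 'cV[A]_m) : u != 0 -> 0 < inner u u.
Proof. by move=> u0; rewrite lt_neqAle inner_ge0 eq_sym inner_eq0 u0. Qed.

Lemma ctrmx_mul_self m (u : 'cV[A]_m) :
  ctrmx u *m u = (real (inner u u))%:M.
Proof.
apply/matrixP => i j; rewrite !ord1 [RHS]mxE eqxx mulr1n /inner.
apply: self_adjoint_realA; rewrite -ctrmxE.
by rewrite ctrmx_mul ctrmxK.
Qed.

Section Realification.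
Variable m : nat.
Implicit Types (M N : 'M[A]_m) (v : 'cV[A]_m) (W : 'M[R]_(m, beta k)).

Definition real_coords v : 'M[R]_(m, beta k) :=
  \matrix_(i, j) component (v i 0) j.

Definition of_real_coords W : 'cV[A]_m := \col_i of_components (W i).

Lemma real_coordsK : cancel real_coords of_real_coords.
Proof.
move=> v; apply/colP => i; rewrite mxE; apply: component_inj => j.
by rewrite components_of mxE.
Qed.

Lemma of_real_coordsK : cancel of_real_coords real_coords.
Proof. by move=> W; apply/matrixP => i j; rewrite !mxE components_of. Qed.

Lemma real_coords_linear r u v :
  real_coords (real r *: u + v) = r *: real_coords u + real_coords v.
Proof.
by apply/matrixP => i j; rewrite !mxE componentD component_real_mul.
Qed.

Lemma of_real_coords_linear r W V :
  of_real_coords (r *: W + V) = real r *: of_real_coords W + of_real_coords V.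
Proof.
apply: (can_inj real_coordsK).
by rewrite real_coords_linear !of_real_coordsK.
Qed.

Definition left_action M W := real_coords (M *m of_real_coords W).

Lemma left_action_linear M : linear (left_action M).
Proof.
move=> r W V; rewrite /left_action of_real_coords_linear mulmxDr scalerealAr.
exact: real_coords_linear.
Qed.

HB.instance Definition _ M :=
  GRing.isLinear.Build R _ _ _ (left_action M) (left_action_linear M).

Definition realification M := lin_mx (left_action M).

(** Matrices over the quaternions have no multilinear determinant. The
    determinant of the R-linear action on A^m = R^(m * beta) takes its
    place: it is multiplicative and, on positive definite matrices, it is
    the beta-th power of the product of the eigenvalues. *)
Definition rdet M : R := \det (realification M).

Lemma mul_realification M v :
  mxvec (real_coords v) *m realification M = mxvec (real_coords (M *m v)).
Proof. by rewrite mul_vec_lin /= /left_action real_coordsK. Qed.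

Lemma realificationM M N :
  realification (M *m N) = realification N *m realification M.
Proof.
have row_ext (S T : 'M[R]_(m * beta k)) :
    (forall v, mxvec (real_coords v) *m S = mxvec (real_coords v) *m T) -> S = T.
  move=> ST; apply/row_matrixP => i; rewrite !rowE.
  by rewrite -[delta_mx _ _]vec_mxK -[vec_mx _]of_real_coordsK ST.
by apply: row_ext => v; rewrite mulmxA !mul_realification mulmxA.
Qed.

Lemma rdetM M N : rdet (M *m N) = rdet M * rdet N.
Proof. by rewrite /rdet realificationM det_mulmx mulrC. Qed.

Lemma realification_diag (d : 'rV[R]_m) :
  realification (diag_mx (map_mx real d)) =
  diag_mx (mxvec (\matrix_(i < m, j < beta k) d 0 i)).
Proof.
apply/row_matrixP => c; rewrite !rowE.
rewrite -[delta_mx _ _]vec_mxK -[vec_mx _]of_real_coordsK mul_realification.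
set v := of_real_coords _; apply/rowP => c'.
case/mxvec_indexP: c' => i j.
rewrite mul_diag_mx mul_mx_diag [RHS]mxE !mxvecE !mxE.
by rewrite component_real_mul mulrC components_of mxE.
Qed.

(** Each real diagonal entry acts once on each of the beta components. *)
Lemma rdet_diag (d : 'rV[R]_m) :
  rdet (diag_mx (map_mx real d)) = (\prod_i d 0 i) ^+ beta k.
Proof.
rewrite /rdet realification_diag det_diag.
rewrite (reindex _ (curry_mxvec_bij _ _)) /=.
rewrite (eq_bigr (fun p : 'I_m * 'I_(beta k) => d 0 p.1)); last first.
  by move=> [i j] _; rewrite /= mxvecE mxE.
rewrite -(pair_bigA _ (fun i (j : 'I_(beta k)) => d 0 i)) /= -prodrXl.
by apply: eq_bigr => i _; rewrite prodr_const card_ord.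
Qed.

Lemma rdet1 : rdet 1%:M = 1.
Proof.
have := rdet_diag (const_mx 1); rewrite map_const_mx realA1 diag_const_mx => ->.
by rewrite big1 ?expr1n// => i _; rewrite mxE.
Qed.

End Realification.

End HermitianMatrices.

(** * The spectral theorem *)

Section Eigenvectors.
Variables (R : realType) (k : algebra_kind).
Local Notation A := (alg R k).
Local Notation real := (@realA R k).

(** Real and imaginary parts of the equation for an eigenvector u + i v with
    eigenvalue a + i b. *)
Lemma complex_eigenvector (N : nat) (M : 'M[R]_N) : (0 < N)%N ->
  exists (a b : R) (u v : 'rV[R]_N), [/\ (u != 0) || (v != 0),
    u *m M = a *: u - b *: v & v *m M = b *: u + a *: v].
Proof.
move=> N0; have [z /eigenvalueP[w wM w0]] :=
  @eigenvalue_closed (R[i])%C _ (map_mx (real_complex R) M) N0.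
exists (complex.Re z), (complex.Im z).
exists (map_mx (@complex.Re R) w), (map_mx (@complex.Im R) w).
split.
- rewrite -negb_and; apply: contra w0 => /andP[/eqP u0 /eqP v0].
  apply/eqP/rowP => i; move/rowP : u0 => /(_ i); move/rowP : v0 => /(_ i).
  by rewrite !mxE; case: (w 0 i) => c d /= -> ->.
- apply/rowP => i; move/rowP : (wM) => /(_ i) /(congr1 (@complex.Re R)).
  rewrite !mxE (big_morph (@complex.Re R) (id1 := 0) (op1 := +%R)); last 2 first.
  + by move=> [? ?] [].
  + by [].
  case: z {wM} => c d; case: (w 0 i) => e f /= <-.
  by apply: eq_bigr => l _; rewrite !mxE; case: (w 0 l) => g h /=; rewrite mulr0 subr0.
- apply/rowP => i; move/rowP : (wM) => /(_ i) /(congr1 (@complex.Im R)).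
  rewrite !mxE (big_morph (@complex.Im R) (id1 := 0) (op1 := +%R)); last 2 first.
  + by move=> [? ?] [].
  + by [].
  case: z {wM} => c d; case: (w 0 i) => e f /= E.
  rewrite [RHS]addrC -E.
  by apply: eq_bigr => l _; rewrite !mxE; case: (w 0 l) => g h /=; rewrite mulr0 add0r.
Qed.

(** The action of S on R^(m * beta) has a complex eigenvalue a + i b, with
    real and imaginary parts x and y of an eigenvector. Expanding both sides
    of inner y (S x) = inner (S y) x gives b (|x|^2 + |y|^2) = 0, so the
    eigenvalue is real. *)
Lemma hermitian_eigenvector m (S : 'M[A]_m.+1) : Defs.hermitian S ->
  exists (r : R) (v : 'cV[A]_m.+1), v != 0 /\ S *m v = real r *: v.
Proof.
move=> hS; have N0 : (0 < m.+1 * beta k)%N by rewrite muln_gt0 beta_gt0.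
have [a [b [u [v [uv0 uS vS]]]]] := complex_eigenvector (realification S) N0.
have real_row (w : 'rV[R]_(m.+1 * beta k)) : exists2 x : 'cV[A]_m.+1,
    w = mxvec (real_coords x) & (x == 0) = (w == 0).
  exists (of_real_coords (vec_mx w)); first by rewrite of_real_coordsK vec_mxK.
  apply/eqP/eqP => [w0|->].
    rewrite -[w]vec_mxK -[vec_mx w]of_real_coordsK w0.
    apply/rowP => c; case/mxvec_indexP: c => i j; rewrite mxvecE !mxE.
    by rewrite -(realA0 R k) components_of; case: ifP.
  apply/colP => i; rewrite !mxE; apply: component_inj => j.
  by rewrite components_of !mxE -(realA0 R k) components_of; case: ifP.
have [x ux x0] := real_row u; have [y vy y0] := real_row v.
have coords_inj (p q : 'cV[A]_m.+1) :
    mxvec (real_coords p) = mxvec (real_coords q) -> p = q.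
  by move=> /(can_inj mxvecK)/(can_inj (@real_coordsK _ _ _)).
have Sx : S *m x = real a *: x + real (- b) *: y.
  apply: coords_inj; rewrite -mul_realification -ux uS ux vy.
  rewrite real_coords_linear linearP /=; congr (_ + _).
  rewrite -scaleNr -linearZ; congr mxvec.
  by apply/matrixP => i j; rewrite !mxE component_real_mul.
have Sy : S *m y = real b *: x + real a *: y.
  apply: coords_inj; rewrite -mul_realification -vy vS ux vy.
  rewrite real_coords_linear linearP /=; congr (_ + _).
  rewrite -linearZ; congr mxvec.
  by apply/matrixP => i j; rewrite !mxE component_real_mul.
have xy0 : 0 < inner x x + inner y y.
  case/orP : uv0; rewrite -?x0 -?y0 => /inner_gt0 xp.
    by rewrite ltr_pwDl// inner_ge0.
  by rewrite ltr_wpDl// inner_ge0.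
have b0 : b = 0.
  have := inner_herm y x hS; rewrite Sx Sy.
  rewrite [RHS]innerC !innerDr !innerZr.
  have -> : inner x y = inner y x by exact: innerC.
  move=> E; have : b * (inner x x + inner y y) = 0 by lra.
  by move/eqP; rewrite mulf_eq0 (gt_eqF xy0) orbF => /eqP.
rewrite b0 ?oppr0 realA0 !scale0r ?addr0 ?add0r in Sx Sy.
case/orP : uv0; rewrite -?x0 -?y0 => p0.
  by exists a, x.
by exists a, y.
Qed.

(** A Householder reflection. The factor c makes the first entry of v real;
    multiplying on the right by it keeps v an eigenvector for the same real
    eigenvalue. Then u = v c and s e_0, where s = |u|, have the same norm
    and a self-adjoint product, and the reflection along w = u - s e_0
    exchanges them. *)
Lemma unitary_first_column m (v : 'cV[A]_(1 + m)) : v != 0 ->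
  exists (c : A) (H : 'M[A]_(1 + m)),
    [/\ ctrmx H = H, H *m H = 1%:M, v *m c%:M != 0 &
        exists s : R, s != 0 /\ H *m (v *m c%:M) = real s *: delta_mx 0 0].
Proof.
move=> v0.
have [c [vc0 vcr]] : exists c : A, v *m c%:M != 0 /\
    conjA ((v *m c%:M) 0 0) = (v *m c%:M) 0 0.
  have [v00|v00] := eqVneq (v 0 0) 0.
    by exists 1; rewrite mulmx1 v00 conjA0.
  exists (conjA (v 0 0)).
  have E : (v *m (conjA (v 0 0))%:M) 0 0 = v 0 0 * conjA (v 0 0).
    by rewrite mxE big_ord1 mxE eqxx mulr1n.
  have nE : v 0 0 * conjA (v 0 0) = real (normA2 (conjA (v 0 0))).
    by rewrite -conj_mulA conjAK.
  rewrite E nE conj_realA; split => //.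
  apply: contra v00 => /eqP/matrixP/(_ 0 0); rewrite E nE mxE => /(congr1 (@reA R k)).
  rewrite reA_real reA0 => /eqP; rewrite normA2_eq0 => /eqP/(congr1 (@conjA R k)).
  by rewrite conjAK conjA0 => ->.
exists c; set u := v *m c%:M in vc0 vcr *.
pose s := Num.sqrt (inner u u).
have s0 : 0 < s by rewrite sqrtr_gt0 inner_gt0.
have ss : s ^+ 2 = inner u u by rewrite sqr_sqrtr// inner_ge0.
pose e0 : 'cV[A]_(1 + m) := delta_mx 0 0.
have e0x (x : 'cV[A]_(1 + m)) : ctrmx e0 *m x = (x 0 0)%:M.
  apply/matrixP => i j; rewrite !ord1 !mxE eqxx mulr1n (bigD1 0)//= !mxE eqxx /=.
  rewrite conjA1 mul1r big1 ?addr0// => l l0.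
  by rewrite !mxE (negbTE l0) /= conjA0 mul0r.
have ie0 : inner e0 e0 = 1.
  by rewrite /inner e0x !mxE /= -(realA1 R k) reA_real.
pose w := u + real (- s) *: e0.
pose t := inner w w.
have ue : u 0 0 = real (reA (u 0 0)) by exact: self_adjoint_realA.
pose r := reA (u 0 0).
have ieu : inner e0 u = r by rewrite /inner e0x mxE eqxx mulr1n.
have tE : t = 2 * (s ^+ 2 - s * r).
  rewrite /t /w !innerDr !innerZr [inner (_ + _) u]innerC [inner (_ + _) e0]innerC.
  rewrite !innerDr !innerZr ie0 (innerC u e0) ieu -ss; ring.
have wu : ctrmx w *m u = (real (t / 2))%:M.
  rewrite /w ctrmxD ctrmxZ mulmxDl -scalemxAl e0x ctrmx_mul_self -ss ue.
  rewrite -[LHS]/(_ + _).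
  have -> : real (- s) *: ((real r)%:M : 'M[A]_1) = (real (- s * r))%:M.
    by rewrite scale_scalar_mx realAM.
  rewrite -raddfD /= -realAD; congr (real _)%:M.
  by rewrite tE; field.
have [w0|w0] := eqVneq w 0.
  exists 1%:M; split => //; [exact: ctrmx1 | exact: mulmx1 |].
  exists s; split; first by rewrite gt_eqF.
  rewrite mul1mx; apply/eqP; rewrite -subr_eq0 -scaleNr -realAN; exact/eqP.
have t0 : t != 0 by rewrite gt_eqF// inner_gt0.
pose H := 1%:M + real (- (2 / t)) *: (w *m ctrmx w).
have wwww : (w *m ctrmx w) *m (w *m ctrmx w) = real t *: (w *m ctrmx w).
  rewrite mulmxA -(mulmxA w) ctrmx_mul_self.
  rewrite -scalemx1 scalerealAr mulmx1.
  by rewrite -scalemxAl.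
exists H; split => //.
- by rewrite /H ctrmxD ctrmx1 ctrmxZ ctrmx_mul ctrmxK.
- rewrite /H mulmxDl mul1mx mulmxDr mulmx1 -scalemxAl scalerealAr wwww.
  rewrite -addrA !scalerA -!realAM -!scalerDl -!realAD.
  rewrite [X in real X](_ : _ = 0) ?realA0 ?scale0r ?addr0//.
  by field.
- exists s; split; first by rewrite gt_eqF.
  rewrite /H mulmxDl mul1mx -scalemxAl -mulmxA wu -scalemx1 scalerealAr mulmx1.
  rewrite scalerA -realAM [X in real X](_ : _ = -1); last by field.
  rewrite realAN realA1 scaleN1r /w opprD addNKr -scaleNr -realAN opprK.
  by [].
Qed.

End Eigenvectors.

Section SpectralTheorem.
Variables (R : realType) (k : algebra_kind).
Local Notation A := (alg R k).
Local Notation real := (@realA R k).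

Lemma ctrmx_block m1 m2 n1 n2 (a : 'M[A]_(m1, n1)) (b : 'M[A]_(m1, n2))
    (c : 'M[A]_(m2, n1)) (d : 'M[A]_(m2, n2)) :
  ctrmx (block_mx a b c d) =
  block_mx (ctrmx a) (ctrmx c) (ctrmx b) (ctrmx d).
Proof.
have ctrE p q (M : 'M[A]_(p, q)) : ctrmx M = map_mx (@conjA R k) (trmx M).
  by apply/matrixP => i j; rewrite !mxE.
by rewrite !ctrE tr_block_mx map_block_mx.
Qed.

(** Induction on the size: a reflection H that sends an eigenvector to a
    multiple of e_0 turns S into a matrix with a 1 x 1 block and a smaller
    hermitian block. *)
Lemma spectral_theorem m (S : 'M[A]_m) : Defs.hermitian S ->
  exists l, eigenvalues_of S l.
Proof.
elim: m => [|m IHm] in S *; first by exists 0, 1%:M; split; apply/matrixP => -[].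
rewrite -[m.+1]/(1 + m)%N in S * => hS.
have [r [v0 [v0n Sv0]]] := hermitian_eigenvector hS.
have [c [H [hH HH vc0 [s [s0 Hv]]]]] := unitary_first_column v0n.
set v := v0 *m c%:M in vc0 Hv.
have Sv : S *m v = real r *: v by rewrite /v mulmxA Sv0 scalemxAl.
pose T := H *m S *m H.
have hT : Defs.hermitian T by rewrite /Defs.hermitian /T !ctrmx_mul hH hS mulmxA.
pose e : 'cV[A]_(1 + m) := delta_mx (lshift m 0) 0.
have eE : delta_mx 0 0 = e by congr delta_mx; exact/val_inj.
rewrite eE in Hv.
have Te0 : T *m e = real r *: e.
  have e0E : e = real s^-1 *: (H *m v).
    by rewrite Hv scalerA -realAM mulVf// realA1 scale1r.
  rewrite [in LHS]e0E scalerealAr /T -!mulmxA (mulmxA H H) HH mul1mx Sv.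
  rewrite scalerealAr scalerA -realAM mulrC realAM -scalerA; congr (_ *: _).
  by rewrite Hv scalerA -realAM mulVf// realA1 scale1r.
have TE i : T i (lshift m 0) = if i == lshift m 0 then real r else 0.
  have := congr1 (fun x : 'cV[A]_(1 + m) => x i 0) Te0.
  rewrite -colE !mxE => ->; rewrite andbT; case: eqP => _; rewrite ?mulr1 ?mulr0//.
have SHT : S *m H = H *m T by rewrite /T !mulmxA HH mul1mx.
move: T hT TE SHT {Te0} => T hT TE SHT; pose T2 := drsubmx T.
have TB : T = block_mx (real r)%:M 0 0 T2.
  rewrite -[T]submxK; congr block_mx; apply/matrixP => i j.
  - by rewrite !ord1 !mxE TE eqxx mulr1n.
  - by rewrite !ord1 !mxE -hT ctrmxE TE eq_rlshift conjA0.
  - by rewrite !ord1 !mxE TE eq_rlshift.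
have hT2 : Defs.hermitian T2.
  apply/matrixP => i j; rewrite ctrmxE !mxE.
  by rewrite -[in LHS]hT ctrmxE conjAK.
have [l [U [UU UU' TU]]] := IHm _ hT2.
pose V := block_mx (1%:M : 'M[A]_1) 0 0 U.
have cV : ctrmx V = block_mx 1%:M 0 0 (ctrmx U).
  rewrite ctrmx_block ctrmx1; congr block_mx;
  by apply/matrixP => i j; rewrite !mxE conjA0.
exists (row_mx (const_mx r) l), (H *m V); split.
- rewrite ctrmx_mul hH mulmxA -(mulmxA _ H H) HH mulmx1 cV /V mulmx_block.
  by rewrite !mulmx0 !mul0mx UU !addr0 !add0r mulmx1 -scalar_mx_block.
- rewrite ctrmx_mul hH mulmxA -(mulmxA H V) cV /V mulmx_block.
  rewrite !mulmx0 !mul0mx UU' !addr0 !add0r mulmx1 -scalar_mx_block mulmx1.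
  exact: HH.
- have -> : S *m (H *m V) = H *m (T *m V).
    by rewrite !mulmxA SHT.
  rewrite -mulmxA; congr (_ *m _); rewrite TB /V map_row_mx diag_mx_row map_const_mx.
  rewrite diag_const_mx !mulmx_block !mulmx0 !mul0mx !addr0 !add0r mul1mx mulmx1.
  by rewrite TU.
Qed.

Lemma eigenvalues_posdef m (S : 'M[A]_m) l i :
  posdef S -> eigenvalues_of S l -> 0 < l 0 i.
Proof.
move=> [hS pS] [U [UU _ SU]].
have Sc : S *m col i U = real (l 0 i) *: col i U.
  rewrite [in LHS]colE mulmxA SU -colE; apply/colP => j.
  rewrite !mxE (bigD1 i)//= !mxE eqxx mulr1n big1 ?addr0 ?realA_comm// => p pi.
  by rewrite !mxE (negbTE pi) mulr0n mulr0.
have uu : inner (col i U) (col i U) = 1.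
  have := congr1 (fun M : 'M[A]_m => reA (M i i)) UU; rewrite [in RHS]mxE eqxx.
  rewrite -[X in _ = reA X](realA1 R k) reA_real => <-.
  rewrite /inner !mxE; congr reA; apply: eq_bigr => j _.
  by rewrite !mxE.
have u0 : col i U != 0 by rewrite -inner_eq0 uu oner_eq0.
have := pS _ u0; rewrite -mulmxA Sc -/(inner _ _) innerZr uu mulr1.
by [].
Qed.

(** hdet is computed from a chosen list of eigenvalues. Since they are
    positive, hdet is the positive beta-th root of rdet, whatever the
    choice; this is how the properties of rdet reach hdet. *)
Lemma hdet_posdef m (S : 'M[A]_m) : posdef S ->
  0 < hdet S /\ hdet S ^+ beta k = rdet S.
Proof.
move=> pS; rewrite /hdet; have := xgetPex 0 (spectral_theorem pS.1).
set l := xget _ _ => Sl.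
split; first by apply: prodr_gt0 => i _; apply: eigenvalues_posdef pS Sl.
have [U [UU UU' SU]] := Sl.
have U0 : rdet U != 0.
  have : rdet U * rdet (ctrmx U) = 1 by rewrite -rdetM UU' rdet1.
  by apply: contra_eqN => /eqP ->; rewrite mul0r eq_sym oner_eq0.
apply: (mulfI U0); rewrite -rdet_diag [RHS]mulrC -!rdetM SU.
by rewrite !rdetM mulrC.
Qed.

End SpectralTheorem.

(** * Sweeps *)

Section Sweep.
Variables (R : realType) (k : algebra_kind) (m : nat).
Local Notation A := (alg R k).
Local Notation real := (@realA R k).
Implicit Types (S : 'M[A]_m) (p : 'I_m) (l : seq 'I_m) (v w : 'cV[A]_m).

Definition pivot p S : R := reA (S p p).

(** The principal pivot transform: if y = S x, it is the matrix of the
    relation in which x_p is exchanged for y_p and y_p for - x_p. The sign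
    makes it preserve hermitian matrices. *)
Definition sweep p S : 'M[A]_m := \matrix_(i, j)
  if i == p then
    if j == p then real (- (pivot p S)^-1) else real (pivot p S)^-1 * S p j
  else if j == p then real (pivot p S)^-1 * S i p
  else S i j - real (pivot p S)^-1 * (S i p * S p j).

Lemma hermitian_pivot p S : Defs.hermitian S -> S p p = real (pivot p S).
Proof. by move=> hS; apply: self_adjoint_realA; rewrite -ctrmxE hS. Qed.

Lemma hermitianE S i j : Defs.hermitian S -> conjA (S i j) = S j i.
Proof. by move=> hS; rewrite -ctrmxE hS. Qed.

Lemma hermitian_sweep p S : Defs.hermitian S -> Defs.hermitian (sweep p S).
Proof.
move=> hS; apply/matrixP => i j; rewrite ctrmxE !mxE.
case: (eqVneq j p) => jp; case: (eqVneq i p) => ip.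
- by rewrite conj_realA.
- by rewrite conjAM conj_realA hermitianE// -realA_comm.
- by rewrite conjAM conj_realA hermitianE// -realA_comm.
- rewrite conjAD conjAN !conjAM conj_realA !hermitianE//.
  by rewrite realA_comm.
Qed.

Definition swap_rows q l (M N : 'M[A]_(m, q)) : 'M[A]_(m, q) :=
  \matrix_(i, j) if i \in l then N i j else M i j.

(** Solve row p of the system S M = N for the p-th row of M and substitute
    it into the other rows. *)
Lemma sweep_swap q p S (M N : 'M[A]_(m, q)) : Defs.hermitian S ->
  pivot p S != 0 -> S *m M = N ->
  sweep p S *m swap_rows [:: p] M N = swap_rows [:: p] N (- M).
Proof.
move=> hS p0 SM; have pK : real (pivot p S)^-1 * S p p = 1.
  by rewrite hermitian_pivot// -realAM mulVf// realA1.
have NE i j : N i j = S i p * M p j + \sum_(h < m | h != p) S i h * M h j.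
  by rewrite -SM mxE (bigD1 p).
apply/matrixP => i j; rewrite [LHS]mxE (bigD1 p)//=.
under eq_bigr => h hp.
  rewrite [swap_rows _ _ _ h j]mxE mem_seq1 (negbTE hp) mxE (negbTE hp).
  over.
rewrite !mxE !mem_seq1 !eqxx; have [->|ip] := eqVneq i p.
  rewrite NE realAN mulNr mulrDr mulrA pK mul1r.
  under eq_bigr do rewrite -mulrA.
  by rewrite -mulr_sumr opprD -addrA addNr addr0.
rewrite [N p j]NE [RHS]NE mulrDr.
have -> : real (pivot p S)^-1 * S i p * (S p p * M p j) = S i p * M p j.
  by rewrite realA_comm -!mulrA (mulrA _ (S p p)) pK mul1r.
rewrite -addrA; congr (_ + _).
under [X in _ + X = _]eq_bigr do rewrite mulrBl.
rewrite big_split /= sumrN addrCA -[RHS]addr0; congr (_ + _).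
rewrite mulr_sumr; apply/eqP; rewrite subr_eq0; apply/eqP.
by apply: eq_bigr => h _; rewrite !mulrA.
Qed.

Definition zero_coord p w : 'cV[A]_m := \col_i if i == p then 0 else w i 0.

(** Completing the square in the p-th coordinate: off row and column p, the
    sweep is the Schur complement of the pivot. *)
Lemma inner_sweep p S w : Defs.hermitian S -> pivot p S != 0 ->
  inner w (S *m w) =
  inner (zero_coord p w) (sweep p S *m zero_coord p w)
  + normA2 ((S *m w) p 0) / pivot p S.
Proof.
move=> hS p0; set v := zero_coord p w; set y := S *m w; set s := pivot p S.
have yE i : y i 0 = S i p * w p 0 + \sum_(h < m | h != p) S i h * w h 0.
  by rewrite mxE (bigD1 p).
have sK : real s^-1 * S p p = 1.
  by rewrite hermitian_pivot// -realAM mulVf// realA1.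
(* the image of v under the sweep has entries y_i - s^-1 S_ip y_p for i != p;
     at i = p this expression is 0 *)
have vE i : conjA (v i 0) * (sweep p S *m v) i 0 =
    conjA (w i 0) * (y i 0 - real s^-1 * (S i p * y p 0)).
  have [->|ip] := eqVneq i p.
    by rewrite mulrA sK mul1r subrr mulr0 mxE eqxx conjA0 mul0r.
  rewrite {1}/v mxE (negbTE ip); congr (_ * _).
  rewrite mxE (bigD1 p)//= [v p 0]mxE eqxx mulr0 add0r.
  rewrite (eq_bigr (fun h => S i h * w h 0
    - real s^-1 * (S i p * (S p h * w h 0)))); last first.
    by move=> h hp; rewrite !mxE (negbTE hp) (negbTE ip) mulrBl !mulrA.
  rewrite sumrB -!mulr_sumr [y i 0]yE [y p 0]yE.
  have sKi : real s^-1 * (S i p * (S p p * w p 0)) = S i p * w p 0.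
    by rewrite mulrA realA_comm -mulrA (mulrA (real _)) sK mul1r.
  by rewrite !mulrDr sKi opprD addrACA subrr add0r.
have cy : conjA (y p 0) = \sum_i conjA (w i 0) * S i p.
  rewrite mxE conjA_sum; apply: eq_bigr => h _.
  by rewrite conjAM hermitianE.
have -> : inner v (sweep p S *m v) = inner w y - s^-1 * normA2 (y p 0).
  rewrite /inner !(mxE _ _ 0 0).
  under eq_bigr do rewrite ctrmxE vE mulrBr.
  rewrite sumrB reAD reAN; congr (_ - _).
    by congr reA; apply: eq_bigr => i _; rewrite ctrmxE.
  rewrite /normA2 -reA_realM cy mulr_suml mulr_sumr; congr reA.
  by apply: eq_bigr => i _; rewrite [LHS]mulrA -realA_comm !mulrA.
by rewrite [_ / _]mulrC subrK.
Qed.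

(** Positivity on the vectors supported in l, the indices not yet swept: the
    rows already swept have lost it, since sweeping changes signs. *)
Definition posdef_on l S : Prop :=
  forall v, v != 0 -> (forall i, i \notin l -> v i 0 = 0) -> 0 < inner v (S *m v).

(** Both directions follow from completing the square: given v, the p-th
    entry can be chosen so that the square vanishes, and otherwise the
    square only helps. *)
Lemma posdef_on_sweep p l S : Defs.hermitian S -> p \notin l ->
  posdef_on (p :: l) S <-> 0 < pivot p S /\ posdef_on l (sweep p S).
Proof.
move=> hS pl; pose e : 'cV[A]_m := delta_mx p 0.
have SeE h : (S *m e) h 0 = S h p by rewrite -colE mxE.
split=> [PS|[p0 PS] w w0 wl].
  have e0 : e != 0.
    apply/eqP => /colP/(_ p); rewrite !mxE !eqxx => /eqP.
    by rewrite oner_eq0.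
  have p0 : 0 < pivot p S.
    have := PS e e0; rewrite /inner mxE (bigD1 p)//= big1 => [|h hp]; last first.
      by rewrite !mxE (negbTE hp) /= conjA0 mul0r.
    rewrite addr0 SeE ctrmxE mxE !eqxx conjA1 mul1r; apply => i.
    by rewrite in_cons negb_or !mxE => /andP[/negbTE ->].
  split=> // v v0 vl.
  (* complete v so that the p-th entry of S *m w vanishes *)
  pose z := \sum_(h < m | h != p) S p h * v h 0.
  pose w : 'cV[A]_m :=
    \col_i if i == p then - (real (pivot p S)^-1 * z) else v i 0.
  have vp : v p 0 = 0 by exact: vl.
  have vw : zero_coord p w = v.
    by apply/colP => i; rewrite !mxE; case: eqP => [->|].
  have Swp : (S *m w) p 0 = 0.
    rewrite mxE (bigD1 p)//= mxE eqxx mulrN mulrA hermitian_pivot//.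
    rewrite -realAM divff ?gt_eqF// realA1 mul1r addrC; apply/eqP.
    rewrite subr_eq0; apply/eqP; apply: eq_bigr => h hp.
    by rewrite mxE (negbTE hp).
  have w0 : w != 0.
    apply: contra v0 => /eqP w0; rewrite -vw w0.
    by apply/eqP/colP => i; rewrite !mxE; case: ifP.
  have := inner_sweep w hS (lt0r_neq0 p0).
  rewrite vw Swp /normA2 mulr0 reA0 mul0r addr0 => <-; apply: PS => // i.
  rewrite in_cons negb_or mxE => /andP[/negbTE -> il]; exact: vl.
rewrite (inner_sweep w hS (lt0r_neq0 p0)); set v := zero_coord p w.
have [v0|v0] := eqVneq v 0; last first.
  rewrite ltr_pwDl// ?divr_ge0 ?normA2_ge0 ?ltW//; apply: PS => // i il.
  rewrite mxE; case: eqP => // /eqP ip; apply: wl.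
  by rewrite in_cons negb_or ip.
rewrite v0 mulmx0 /inner mulmx0 mxE reA0 add0r divr_gt0//.
have wE : w = e *m (w p 0)%:M.
  apply/colP => i; move/colP : v0 => /(_ i); rewrite !mxE big_ord1 !mxE eqxx mulr1n.
  by case: eqP => [-> _|_ ->]; rewrite ?mul1r ?mul0r.
have wp : w p 0 != 0.
  apply: contra w0 => /eqP wp; rewrite wE wp.
  by apply/eqP/matrixP => i j; rewrite !mxE big_ord1 !mxE mul0rn mulr0.
have -> : (S *m w) p 0 = real (pivot p S) * w p 0.
  by rewrite {1}wE mulmxA mxE big_ord1 SeE hermitian_pivot// mxE eqxx mulr1n.
rewrite lt_neqAle normA2_ge0 andbT eq_sym normA2_eq0.
apply: contra wp => /eqP/(congr1 ( *%R (real (pivot p S)^-1))).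
by rewrite mulrA -realAM mulVf ?gt_eqF// realA1 mul1r mulr0 => ->.
Qed.

Fixpoint sweeps l S : 'M[A]_m :=
  if l is p :: l' then sweeps l' (sweep p S) else S.

Fixpoint pivots l S : seq R :=
  if l is p :: l' then pivot p S :: pivots l' (sweep p S) else [::].

Lemma hermitian_sweeps l S : Defs.hermitian S -> Defs.hermitian (sweeps l S).
Proof. by elim: l S => //= p l IH S hS; apply/IH/hermitian_sweep. Qed.

Lemma posdef_on_pivots l S : Defs.hermitian S -> uniq l ->
  posdef_on l S <-> all (>%R^~ 0) (pivots l S).
Proof.
elim: l S => [S _ _|p l IH S hS /= /andP[pl ul]].
  split=> // _ v /eqP v0 vl; case: v0; apply/colP => i.
  by rewrite mxE; exact: vl.
have IHS := IH _ (hermitian_sweep p hS) ul.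
rewrite (propext (posdef_on_sweep hS pl)) (propext IHS).
by split => /andP.
Qed.

Lemma posdef_pivots S : Defs.hermitian S ->
  posdef S <-> all (>%R^~ 0) (pivots (enum 'I_m) S).
Proof.
move=> hS; rewrite -(propext (posdef_on_pivots hS (enum_uniq _))).
split=> [[_ PS] v v0 _|PS]; first by rewrite /inner mulmxA; exact: PS.
split=> // v v0; rewrite -mulmxA; apply: PS => // i.
by rewrite mem_enum.
Qed.

Lemma swap_rows_cons q p l (M N : 'M[A]_(m, q)) : p \notin l ->
  swap_rows l (swap_rows [:: p] M N) (swap_rows [:: p] N (- M)) =
  swap_rows (p :: l) M N.
Proof.
move=> pl; apply/matrixP => i j; rewrite !mxE mem_seq1 in_cons.
by have [->|ip] := eqVneq i p => //=; rewrite (negbTE pl).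
Qed.

Lemma swap_rows_consN q p l (M N : 'M[A]_(m, q)) : p \notin l ->
  swap_rows l (swap_rows [:: p] N (- M)) (- swap_rows [:: p] M N) =
  swap_rows (p :: l) N (- M).
Proof.
move=> pl; apply/matrixP => i j; rewrite !mxE mem_seq1 in_cons.
by have [->|ip] := eqVneq i p => //=; rewrite (negbTE pl).
Qed.

Lemma sweeps_swap q l S (M N : 'M[A]_(m, q)) : Defs.hermitian S -> uniq l ->
  all (fun r => r != 0) (pivots l S) -> S *m M = N ->
  sweeps l S *m swap_rows l M N = swap_rows l N (- M).
Proof.
elim: l S M N => [|p l IH] S M N hS /=.
  move=> _ _ SM; have E (U V : 'M[A]_(m, q)) : swap_rows [::] U V = U.
    by apply/matrixP => i j; rewrite mxE.
  by rewrite !E.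
move=> /andP[pl ul] /andP[p0 pS] SM.
rewrite -(swap_rows_cons M N pl) -(swap_rows_consN M N pl); apply: IH => //.
  exact: hermitian_sweep.
exact: sweep_swap.
Qed.

(** Once all coordinates are exchanged, the relation y = S x reads - x = T
    y, so that - T is the inverse of S. *)
Lemma sweeps_enum S : Defs.hermitian S ->
  all (fun r => r != 0) (pivots (enum 'I_m) S) ->
  S *m (- sweeps (enum 'I_m) S) = 1%:M /\ (- sweeps (enum 'I_m) S) *m S = 1%:M.
Proof.
move=> hS pS; have := sweeps_swap hS (enum_uniq _) pS (mulmx1 S).
have E (U V : 'M[A]_m) : swap_rows (enum 'I_m) U V = V.
  by apply/matrixP => i j; rewrite mxE mem_enum.
rewrite !E => TS; have L : (- sweeps (enum 'I_m) S) *m S = 1%:M.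
  by rewrite mulNmx TS opprK.
split=> //; rewrite -[LHS]ctrmxK ctrmx_mul ctrmxN hS hermitian_sweeps// L.
exact: ctrmx1.
Qed.

End Sweep.

(** * Pivots and determinants *)

Section SweepDet.
Variables (R : realType) (k : algebra_kind) (m : nat).
Local Notation A := (alg R k).
Local Notation real := (@realA R k).
Implicit Types (S : 'M[A]_m) (p : 'I_m) (l : seq 'I_m).

Definition diag_at p (r : R) : 'M[A]_m :=
  diag_mx (map_mx real (\row_i if i == p then r else 1)).

Lemma rdet_diag_at p r : rdet (diag_at p r) = r ^+ beta k.
Proof.
rewrite rdet_diag (bigD1 p)//= mxE eqxx big1 ?mulr1// => i ip.
by rewrite mxE (negbTE ip).
Qed.

(** The matrix is 1 + N with N^2 = 0. Conjugation by diag_at p 2 doubles N,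
    and 1 + 2 N = (1 + N)^2, so the determinant equals its own square. *)
Lemma rdet_transvection p (u : 'rV[A]_m) : u 0 p = 0 ->
  rdet (1%:M + delta_mx p 0 *m u) = 1.
Proof.
move=> up; set N := delta_mx p 0 *m u.
have NE i j : N i j = if i == p then u 0 j else 0.
  rewrite mxE big_ord1 mxE eqxx andbT.
  by case: eqP; rewrite ?mul1r ?mul0r.
clearbody N.
have NN : N *m N = 0.
  apply/matrixP => i j; rewrite !mxE big1// => h _; rewrite !NE.
  by case: (eqVneq h p) => [->|]; rewrite ?up ?if_same ?mulr0 ?mul0r.
have DN : diag_at p 2 *m N = N + N.
  apply/matrixP => i j; rewrite mul_diag_mx !mxE !NE.
  case: eqP => _; last by rewrite mulr0 addr0.
  by rewrite -[2]/(1 + 1) realAD realA1 mulrDl mul1r.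
have ND : N *m diag_at p 2 = N.
  apply/matrixP => i j; rewrite mul_mx_diag !mxE !NE.
  case: eqP => // _; last by rewrite mul0r.
  by case: eqP => [->|_]; rewrite ?up ?mul0r// realA1 mulr1.
have tt : rdet (1%:M + N) * rdet (1%:M - N) = 1.
  rewrite -rdetM mulmxDl mul1mx mulmxBr mulmx1 NN subr0.
  by rewrite subrK rdet1.
have t0 : rdet (1%:M + N) != 0.
  by apply: contra_eqN tt => /eqP ->; rewrite mul0r eq_sym oner_eq0.
apply: (mulfI t0); rewrite mulr1 -rdetM.
have d0 : rdet (diag_at p 2) != 0 by rewrite rdet_diag_at expf_neq0// pnatr_eq0.
apply: (mulIf d0); rewrite -rdetM [RHS]mulrC -rdetM; congr rdet.
rewrite !mulmxDl !mulmxDr !mul1mx !mulmx1 NN addr0 !mulmxDl ND DN mul1mx.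
by rewrite addrA.
Qed.

(** A transvection followed by a rescaling of column p. *)
Lemma rdet_swap_row p S : Defs.hermitian S ->
  rdet (swap_rows [:: p] 1%:M S) = pivot p S ^+ beta k.
Proof.
move=> hS; pose u : 'rV[A]_m := \row_j if j == p then 0 else S p j.
have -> : swap_rows [:: p] 1%:M S =
    (1%:M + delta_mx p 0 *m u) *m diag_at p (pivot p S).
  apply/matrixP => i j; rewrite mul_mx_diag !mxE mem_seq1 big_ord1 !mxE eqxx andbT.
  have [->|ip] := eqVneq i p; have [->|jp] := eqVneq j p.
  - by rewrite mulr0 addr0 mul1r hermitian_pivot.
  - by rewrite add0r mul1r realA1 mulr1.
  - by rewrite (negbTE ip) mul0r add0r mul0r.
  - by rewrite mul0r addr0 realA1 mulr1.
by rewrite rdetM rdet_transvection ?mul1r ?rdet_diag_at// mxE eqxx.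
Qed.

(** After the first sweep the exchanged rows are M with row p replaced by
    row p of S M, that is, M multiplied by the matrix of rdet_swap_row; the
    remaining sweeps are handled by induction. *)
Lemma rdet_swap_rows l S (M N : 'M[A]_m) : Defs.hermitian S -> uniq l ->
  all (fun r => r != 0) (pivots l S) -> S *m M = N ->
  rdet (swap_rows l M N) = (\prod_(r <- pivots l S) r) ^+ beta k * rdet M.
Proof.
elim: l S M N => [|p l IH] S M N hS /=.
  move=> _ _ SM; rewrite big_nil expr1n mul1r; congr rdet.
  by apply/matrixP => i j; rewrite mxE.
move=> /andP[pl ul] /andP[p0 pS] SM.
rewrite -(swap_rows_cons M N pl) (IH (sweep p S))//.
- rewrite big_cons exprMn mulrAC mulrC; congr (_ * _).
  have -> : swap_rows [:: p] M N = swap_rows [:: p] 1%:M S *m M.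
    apply/matrixP => i j; rewrite mxE mem_seq1.
    have [->|ip] := eqVneq i p.
      rewrite -SM !mxE; apply: eq_bigr => h _.
      by rewrite mxE mem_seq1 eqxx.
    rewrite mxE (bigD1 i)//= !mxE mem_seq1 (negbTE ip) eqxx mul1r big1 ?addr0// => h hi.
    by rewrite !mxE mem_seq1 (negbTE ip) eq_sym (negbTE hi) mul0r.
  by rewrite rdetM rdet_swap_row// mulrC.
- exact: hermitian_sweep.
- exact: sweep_swap.
Qed.

Lemma rdet_pivots S : Defs.hermitian S ->
  all (fun r => r != 0) (pivots (enum 'I_m) S) ->
  rdet S = (\prod_(r <- pivots (enum 'I_m) S) r) ^+ beta k.
Proof.
move=> hS pS; have := rdet_swap_rows hS (enum_uniq _) pS (mulmx1 S).
rewrite rdet1 mulr1 => <-; congr rdet.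
by apply/matrixP => i j; rewrite mxE mem_enum.
Qed.

Lemma pivots_neq0 S : posdef S -> all (fun r => r != 0) (pivots (enum 'I_m) S).
Proof.
move=> pS; have /allP pos := (posdef_pivots pS.1).1 pS.
by apply/allP => r /pos r0; rewrite gt_eqF.
Qed.

Lemma hdet_pivots S : posdef S -> hdet S = \prod_(r <- pivots (enum 'I_m) S) r.
Proof.
move=> pS; have [d0 dE] := hdet_posdef pS.
have /allP pos := (posdef_pivots pS.1).1 pS.
have P0 : 0 < \prod_(r <- pivots (enum 'I_m) S) r.
  by rewrite big_seq; apply: prodr_gt0 => r /pos.
apply/eqP; rewrite -(@eqrXn2 _ (beta k)) ?beta_gt0 ?(ltW d0) ?(ltW P0)//.
by rewrite dE rdet_pivots// ?pivots_neq0//; exact: pS.1.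
Qed.

Lemma hinv_unique S T : S *m T = 1%:M -> T *m S = 1%:M -> hinv S = T.
Proof.
move=> ST TS; rewrite /hinv.
have [SB BS] := @xgetI _ 0 [set B | S *m B = 1%:M /\ B *m S = 1%:M] T (conj ST TS).
by move: (xget _ _) SB => B SB; rewrite -[LHS]mul1mx -TS -mulmxA SB mulmx1.
Qed.

Lemma hinv_sweeps S : Defs.hermitian S ->
  all (fun r => r != 0) (pivots (enum 'I_m) S) ->
  hinv S = - sweeps (enum 'I_m) S.
Proof. by move=> hS /(sweeps_enum hS)[]; exact: hinv_unique. Qed.

Lemma hinvP S : posdef S -> S *m hinv S = 1%:M /\ hinv S *m S = 1%:M.
Proof.
move=> pS; rewrite hinv_sweeps ?pivots_neq0//; last exact: pS.1.
by apply: sweeps_enum; [exact: pS.1|exact: pivots_neq0].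
Qed.

(** Substituting v = S w, the form of T at v is the form of S at w. *)
Lemma posdef_inverse S T : posdef S -> S *m T = 1%:M -> Defs.hermitian T -> posdef T.
Proof.
move=> [hS pS] ST hT; split=> // v v0.
have vE : v = S *m (T *m v) by rewrite mulmxA ST mul1mx.
have Tv0 : T *m v != 0 by apply: contra v0 => /eqP Tv; rewrite vE Tv mulmx0.
by have := pS _ Tv0; rewrite ctrmx_mul hT -!mulmxA -vE mulmxA.
Qed.

Lemma posdef_hinv S : posdef S -> posdef (hinv S).
Proof.
move=> pS; apply: (posdef_inverse pS); first exact: (hinvP pS).1.
have hS := pS.1; rewrite hinv_sweeps ?pivots_neq0//.
by rewrite /Defs.hermitian ctrmxN hermitian_sweeps.
Qed.

Lemma hinvK S : posdef S -> hinv (hinv S) = S.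
Proof. by move=> pS; have [h1 h2] := hinvP pS; exact: hinv_unique. Qed.

Lemma hdet_hinv S : posdef S -> hdet (hinv S) = (hdet S)^-1.
Proof.
move=> pS; have [d0 dE] := hdet_posdef pS.
have [i0 iE] := hdet_posdef (posdef_hinv pS).
apply/eqP; rewrite -(@eqrXn2 _ (beta k)) ?beta_gt0 ?invr_ge0 ?(ltW d0) ?(ltW i0)//.
have := rdetM (hinv S) S; rewrite (hinvP pS).2 rdet1 => E.
apply/eqP; rewrite iE exprVn dE -[RHS]mul1r E mulfK//.
by rewrite -dE expf_neq0// gt_eqF.
Qed.

End SweepDet.

(** * Real coordinates of hermitian matrices *)

Section Coordinates.
Variables (R : realType) (k : algebra_kind) (m : nat).
Local Notation A := (alg R k).
Local Notation RT := (measurableTypeR R).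
Local Notation real := (@realA R k).
Local Notation N := (hdim k m).
Local Notation coordT := (N.-tuple RT).
Implicit Types (S : 'M[A]_m) (p i j : 'I_m) (x y : coordT) (c : hcoord k m).
Local Notation mat := (@herm_of_tuple R k m).

Definition coordinate x c : R := tnth x (enum_rank c).

Lemma herm_entry_diag (z : hcoord k m -> R) i : herm_entry z i i = real (z (inl i)).
Proof. by rewrite /herm_entry insubN//= ltnn. Qed.

Lemma matE_diag x i : mat x i i = real (coordinate x (inl i)).
Proof. by rewrite mxE leqnn herm_entry_diag. Qed.

Lemma matE_upper x (u : {q : 'I_m * 'I_m | (q.1 < q.2)%N}) :
  mat x (val u).1 (val u).2 = of_components (fun l => coordinate x (inr (u, l))).
Proof.
rewrite mxE (ltnW (valP u)) /herm_entry.
have -> : ((val u).1, (val u).2) = val u by case: (val u).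
by rewrite valK.
Qed.

Lemma hermitian_mat x : Defs.hermitian (mat x).
Proof.
apply/matrixP => i j; rewrite ctrmxE !mxE; case: (ltngtP i j) => ij.
- exact: conjAK.
- by [].
- have -> : i = j by exact/val_inj.
  by rewrite herm_entry_diag conj_realA.
Qed.

Lemma coordinate_coords S c : coordinate (coords S) c = coord_of S c.
Proof. by rewrite /coordinate tnth_mktuple enum_rankK. Qed.

Lemma coordinate_inj x y : (forall c, coordinate x c = coordinate y c) -> x = y.
Proof.
move=> xy; apply/eq_from_tnth => j; have := xy (enum_val j).
by rewrite /coordinate enum_valK.
Qed.

Lemma coords_matK : cancel mat (@coords R k m).
Proof.
move=> x; apply: coordinate_inj => c; rewrite coordinate_coords.
case: c => [i|[u l]] /=; first by rewrite matE_diag reA_real.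
by rewrite matE_upper components_of.
Qed.

Lemma mat_coordsK S : Defs.hermitian S -> mat (coords S) = S.
Proof.
move=> hS.
have U i j : (i < j)%N -> mat (coords S) i j = S i j.
  move=> ij; pose u : {q : 'I_m * 'I_m | (q.1 < q.2)%N} := exist _ (i, j) ij.
  have -> := matE_upper (coords S) u; apply: component_inj => l.
  by rewrite components_of coordinate_coords.
apply/matrixP => i j; case: (ltngtP i j) => ij; first exact: U.
- by rewrite -[LHS](hermitianE _ _ (hermitian_mat _)) U// hermitianE.
- have -> : i = j by exact/val_inj.
  by rewrite matE_diag coordinate_coords /= [RHS]hermitian_pivot.
Qed.

Definition measurableA d (T : measurableType d) (f : T -> A) : Prop :=
  forall l, measurable_fun setT (fun t => component (f t) l).

Lemma measurable_coordinate c : measurable_fun setT (coordinate^~ c : coordT -> R).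
Proof. exact: measurable_tnth. Qed.

Section MeasurableA.
Context d (T : measurableType d).
Implicit Types f g : T -> A.

Lemma measurableA_re f : measurableA f -> measurable_fun setT (fun t => reA (f t)).
Proof. by move=> /(_ (Ordinal (@beta_gt0 k))). Qed.

Lemma measurableA_conj f : measurableA f -> measurableA (fun t => conjA (f t)).
Proof.
rewrite /measurableA /component.
case: k f => [|f mf [[|[|//]] lk] /=|f mf [[|[|[|[|//]]]] lk] /=] //.
- exact: (mf (Ordinal lk)).
- exact/measurable_funN/(mf (Ordinal lk)).
- exact: (mf (Ordinal lk)).
- exact/measurable_funN/(mf (Ordinal lk)).
- exact/measurable_funN/(mf (Ordinal lk)).
- exact/measurable_funN/(mf (Ordinal lk)).
Qed.

Lemma measurableAM f g : measurableA f -> measurableA g ->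
  measurableA (fun t => f t * g t).
Proof.
rewrite /measurableA /component.
case: k f g => [f g mf mg [[|//] lk]/=|f g mf mg|f g mf mg] /=.
- by apply: measurable_funM; [exact: (mf (Ordinal lk))|exact: (mg (Ordinal lk))].
- have f0 := mf (Ordinal (isT : (0 < 2)%N)); have f1 := mf (Ordinal (isT : (1 < 2)%N)).
  have g0 := mg (Ordinal (isT : (0 < 2)%N)); have g1 := mg (Ordinal (isT : (1 < 2)%N)).
  move=> /= in f0 f1 g0 g1 *.
  move=> [[|[|//]] lk] /=.
    rewrite (_ : (fun t => _) = fun t => complex.Re (f t) * complex.Re (g t)
      - complex.Im (f t) * complex.Im (g t)).
      by apply: measurable_funB; apply: measurable_funM.
    by apply/funext => t; case: (f t); case: (g t).
  rewrite (_ : (fun t => _) = fun t => complex.Re (f t) * complex.Im (g t)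
      + complex.Im (f t) * complex.Re (g t)).
    by apply: measurable_funD; apply: measurable_funM.
  by apply/funext => t; case: (f t); case: (g t).
- have f0 := mf (Ordinal (isT : (0 < 4)%N)); have f1 := mf (Ordinal (isT : (1 < 4)%N)).
  have f2 := mf (Ordinal (isT : (2 < 4)%N)); have f3 := mf (Ordinal (isT : (3 < 4)%N)).
  have g0 := mg (Ordinal (isT : (0 < 4)%N)); have g1 := mg (Ordinal (isT : (1 < 4)%N)).
  have g2 := mg (Ordinal (isT : (2 < 4)%N)); have g3 := mg (Ordinal (isT : (3 < 4)%N)).
  move=> /= in f0 f1 f2 f3 g0 g1 g2 g3 *.
  by move=> [[|[|[|[|//]]]] lk] /=;
    do ![apply: measurable_funB|apply: measurable_funD|apply: measurable_funM].
Qed.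

End MeasurableA.

Lemma measurable_mat i j : measurableA (fun x => mat x i j).
Proof.
have U (u v : 'I_m) : (u < v)%N -> measurableA (fun x => mat x u v).
  move=> uv l; pose q : {q : 'I_m * 'I_m | (q.1 < q.2)%N} := exist _ (u, v) uv.
  under eq_fun => x do rewrite (matE_upper x q) components_of.
  exact: measurable_coordinate.
case: (ltngtP i j) => ij; first exact: U.
- rewrite (_ : (fun x => _) = fun x => conjA (mat x j i)).
    by apply: measurableA_conj; exact: U.
  by apply/funext => x; rewrite (hermitianE j i (hermitian_mat x)).
- have <- : i = j by exact/val_inj.
  rewrite (_ : (fun x => _) = fun x => real (coordinate x (inl i))).
    move=> l; under eq_fun => x do rewrite components_of.
    by case: (l == 0 :> nat) => /=; [exact: measurable_coordinate|exact: measurable_cst].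
  by apply/funext => x; rewrite matE_diag.
Qed.

End Coordinates.

(** * The Jacobian of a sweep *)

Section SweepTransport.
Variables (R : realType) (k : algebra_kind) (m : nat).
Local Notation A := (alg R k).
Local Notation RT := (measurableTypeR R).
Local Notation real := (@realA R k).
Local Notation N := (hdim k m).
Local Notation coordT := (N.-tuple RT).
Implicit Types (S : 'M[A]_m) (p i j : 'I_m) (x y : coordT) (c : hcoord k m).
Local Notation mat := (@herm_of_tuple R k m).

Definition sweep_coords p x : coordT := coords (sweep p (mat x)).

Definition inverse_pivot p x : R := (coordinate x (inl p))^-1.

Lemma pivot_mat p x : pivot p (mat x) = coordinate x (inl p).
Proof. by rewrite /pivot matE_diag reA_real. Qed.

Lemma mat_sweep_coords p x : mat (sweep_coords p x) = sweep p (mat x).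
Proof. by rewrite mat_coordsK//; exact/hermitian_sweep/hermitian_mat. Qed.

Lemma measurable_inverse_pivot p : measurable_fun setT (inverse_pivot p).
Proof.
apply: (measurableT_comp (@measurable_invr R)).
exact: measurable_coordinate.
Qed.

Definition column_product p S : 'M[A]_m := \matrix_(i, j) (S i p * S p j).

(** The entry of index (i, p) is stored at whichever of (i, p) and (p, i)
    lies above the diagonal. The value inl p is a default, reached only when
    i = p. *)
Definition column_coord p (i : 'I_m) (l : 'I_(beta k)) : hcoord k m :=
  if insub (i, p) is Some u then inr (u, l)
  else if insub (p, i) is Some u then inr (u, l) else inl p.

(** An explicit enumeration, because its length is the number of coordinates
    that a sweep rescales and becomes an exponent of the Jacobian. *)
Definition column_coords p : seq (hcoord k m) :=
  [seq column_coord p i l | i <- enum (predC1 p), l <- enum 'I_(beta k)].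

Lemma column_coordP p i l : i != p ->
  exists u, column_coord p i l = inr (u, l) /\
   ((val u = (i, p)) \/ (val u = (p, i))).
Proof.
move=> ip; rewrite /column_coord; case: insubP => [u _ uE|/= ip'].
  by exists u; split=> //; left.
case: insubP => [u _ uE|/= pi']; first by exists u; split=> //; right.
by case: ltngtP ip ip' pi' => // /val_inj ->; rewrite eqxx.
Qed.

Lemma size_column_coords p : size (column_coords p) = (m.-1 * beta k)%N.
Proof.
rewrite size_allpairs -!cardE card_ord; congr muln.
by have := cardC1 p; rewrite card_ord.
Qed.

Lemma uniq_column_coords p : uniq (column_coords p).
Proof.
apply: allpairs_uniq; rewrite ?enum_uniq//.
move=> [i l] [j l'] /allpairsP[[i1 l1] [/= i1p _ [-> ->]]].
move=> /allpairsP[[j1 l1'] [/= j1p _ [-> ->]]].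
rewrite !mem_enum !inE in i1p j1p.
have [u [-> uE]] := column_coordP l1 i1p.
have [v [-> vE]] := column_coordP l1' j1p.
move=> [uv ->]; rewrite -{}uv in vE.
case: uE vE => -> [] [].
- by move=> ->.
- by move=> e1; rewrite e1 eqxx in i1p.
- by move=> _ e1; rewrite e1 eqxx in i1p.
- by move=> ->.
Qed.

Lemma mem_column_coords p u l :
  ((inr (u, l) : hcoord k m) \in column_coords p) = ((val u).1 == p) || ((val u).2 == p).
Proof.
have u12 : (val u).1 != (val u).2 by rewrite -val_eqE neq_ltn (valP u).
apply/idP/idP.
  move=> /allpairsP[[i l'] [/= ip _ ul]]; rewrite mem_enum inE in ip.
  have [v [vE vip]] := column_coordP l' ip.
  move: ul; rewrite vE => -[-> _].
  by case: vip => ->; rewrite /= eqxx ?orbT.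
move=> up; pose i := if (val u).1 == p then (val u).2 else (val u).1.
apply/allpairsP; exists (i, l); rewrite /= mem_enum inE mem_enum; split=> //.
  rewrite /i; case: (eqVneq (val u).1 p) up => //= u1 _.
  by rewrite eq_sym -u1.
rewrite /column_coord /i; case: (eqVneq (val u).1 p) up => /= [u1 _|u1 /eqP u2].
  have -> : ((val u).2, p) = ((val u).2, (val u).1) by rewrite u1.
  rewrite insubN/=; last by rewrite -leqNgt ltnW// (valP u).
  have -> : (p, (val u).2) = val u by rewrite [RHS]surjective_pairing -u1.
  by rewrite valK.
have -> : ((val u).1, p) = val u by rewrite [RHS]surjective_pairing -u2.
by rewrite valK.
Qed.

Lemma inl_column_coords p i : (inl i : hcoord k m) \notin column_coords p.
Proof.
apply/negP => /allpairsP[[j l] [/= jp _]]; rewrite mem_enum inE in jp.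
by have [v [-> _]] := column_coordP l jp.
Qed.

(** Needed because the translations of a sweep must not depend on the
    coordinates that they move. *)
Lemma column_mat_eq p x y :
  (forall c, (c == inl p) || (c \in column_coords p) ->
     coordinate x c = coordinate y c) ->
  forall i, mat x i p = mat y i p /\ mat x p i = mat y p i.
Proof.
move=> xy i.
suff H : mat x i p = mat y i p.
  split=> //; rewrite -(hermitianE i p (hermitian_mat x)) H.
  exact: hermitianE (hermitian_mat y).
have U (u v : 'I_m) : (u < v)%N -> (u == p) || (v == p) -> mat x u v = mat y u v.
  move=> uv uvp; pose q : {q : 'I_m * 'I_m | (q.1 < q.2)%N} := exist _ (u, v) uv.
  rewrite (matE_upper x q) (matE_upper y q); apply: component_inj => l.
  by rewrite !components_of; apply: xy; apply/orP; right; rewrite mem_column_coords.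
case: (ltngtP i p) => ip; first by rewrite U// eqxx orbT.
- rewrite -(hermitianE p i (hermitian_mat x)) U ?eqxx//.
  exact: hermitianE (hermitian_mat y).
- by have -> : i = p by [exact/val_inj]; rewrite !matE_diag xy ?eqxx.
Qed.

Lemma coord_of_sweep_pivot p S : coord_of (sweep p S) (inl p) = - (pivot p S)^-1.
Proof. by rewrite /= mxE eqxx reA_real. Qed.

Lemma coord_of_sweep_column p S c : c \in column_coords p ->
  coord_of (sweep p S) c = coord_of S c * (pivot p S)^-1.
Proof.
case: c => [i|[u l]]; first by rewrite (negbTE (inl_column_coords p i)).
have u12 : (val u).1 != (val u).2 by rewrite -val_eqE neq_ltn (valP u).
rewrite mem_column_coords /= mxE; case: (eqVneq (val u).1 p) => [u1 _|u1 /= u2].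
  by rewrite -u1 eq_sym (negbTE u12) component_real_mul mulrC.
by rewrite u2 component_real_mul (eqP u2) mulrC.
Qed.

Lemma coord_of_sweep_rest p S c : c != inl p -> c \notin column_coords p ->
  coord_of (sweep p S) c =
  coord_of S c - (pivot p S)^-1 * coord_of (column_product p S) c.
Proof.
case: c => [i|[u l]] /=.
  move=> ip _; have {}ip : i != p by apply: contra ip => /eqP ->.
  by rewrite !mxE (negbTE ip) reAD reAN reA_realM.
rewrite mem_column_coords negb_or => _ /andP[u1 u2].
by rewrite !mxE (negbTE u1) (negbTE u2) componentD componentN component_real_mul.
Qed.

Lemma measurable_column_product p c :
  measurable_fun setT (fun x => coord_of (column_product p (mat x)) c).
Proof.
have mQ i j : measurableA (fun x => column_product p (mat x) i j).
  rewrite (_ : (fun x => _) = fun x => mat x i p * mat x p j).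
    by apply: measurableAM; exact: measurable_mat.
  by apply/funext => x; rewrite mxE.
case: c => [i|[u l]] /=; last exact: mQ.
exact: measurableA_re (mQ i i).
Qed.

Lemma measurable_sweep_coords p : measurable_fun setT (sweep_coords p).
Proof.
apply/measurable_fun_tnthP => j.
rewrite (_ : _ \o _ = fun x => coordinate (sweep_coords p x) (enum_val j)); last first.
  by apply/funext => x /=; rewrite /coordinate enum_valK.
move: (enum_val j) => c; under eq_fun do rewrite coordinate_coords.
have mV := measurable_inverse_pivot p.
have [->|cp] := eqVneq c (inl p).
  under eq_fun do rewrite coord_of_sweep_pivot pivot_mat.
  exact: measurable_funN.
have mc : measurable_fun setT (fun x => coord_of (mat x) c).
  under eq_fun do rewrite -coordinate_coords coords_matK.
  exact: measurable_coordinate.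
case: (boolP (c \in column_coords p)) => cl.
  under eq_fun do rewrite coord_of_sweep_column// pivot_mat.
  exact: measurable_funM.
under eq_fun do rewrite coord_of_sweep_rest// pivot_mat.
apply: measurable_funB => //; apply: measurable_funM => //.
exact: measurable_column_product.
Qed.

(** In real coordinates a sweep first translates the coordinates away from
    row and column p by quantities that depend only on that row and the
    pivot, then divides the (m - 1) * beta coordinates of that row by the
    pivot t, and finally sends t to - 1/t. The Jacobians are 1, a power of
    |1/t| and 1/t^2. *)
Lemma transports_sweep p : transports (sweep_coords p)
  (fun x => `|inverse_pivot p x| ^+ (m.-1 * beta k + 2)).
Proof.
(* A scaling factor must be nonzero for all x. Its value at a null pivot
   is immaterial, since the weight t^-2 of the last step is then 0. *)
pose s x : R := if coordinate x (inl p) == 0 then 1 else inverse_pivot p x.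
have ms : measurable_fun setT s.
  apply: measurable_fun_ifT => //; last exact: measurable_inverse_pivot.
  apply: (measurable_fun_eqr (measurable_coordinate (inl p))).
  exact: measurable_cst.
have s0 x : s x != 0.
  by rewrite /s; case: ifPn; rewrite ?oner_eq0 ?invr_eq0.
pose Lc := [seq enum_rank c | c <- column_coords p].
pose Lr := [seq j <- enum 'I_N |
  (enum_val j != inl p) && (enum_val j \notin column_coords p)].
have LcE c : (enum_rank c \in Lc) = (c \in column_coords p).
  by rewrite mem_map//; exact: enum_rank_inj.
have LrE c : (enum_rank c \in Lr) = (c != inl p) && (c \notin column_coords p).
  by rewrite mem_filter mem_enum andbT enum_rankK.
have pLc : enum_rank (inl p) \notin Lc by rewrite LcE inl_column_coords.
have pLr : enum_rank (inl p) \notin Lr by rewrite LrE eqxx.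
pose g (h : 'I_N) x : R := - (s x * coord_of (column_product p (mat x)) (enum_val h)).
pose phi1 (h : 'I_N) x : RT := tnth x h + g h x.
pose phi2 (h : 'I_N) x : RT := tnth x h * s x.
have sE x y : coordinate x (inl p) = coordinate y (inl p) -> s x = s y.
  by rewrite /s /inverse_pivot => ->.
have gE (h : 'I_N) x y :
    (forall i : 'I_N, i \notin Lr -> tnth x i = tnth y i) -> g h x = g h y.
  move=> xy; rewrite /g (sE x y) ?/coordinate ?xy//; congr (- (_ * _)).
  have -> // : column_product p (mat x) = column_product p (mat y).
  apply/matrixP => i j; rewrite [LHS]mxE [RHS]mxE.
  have xyc c : (c == inl p) || (c \in column_coords p) -> coordinate x c = coordinate y c.
    by move=> cp; apply: xy; rewrite LrE -negb_or cp.
  by rewrite (column_mat_eq xyc i).1 (column_mat_eq xyc j).2.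
have T1 : transports (update_on Lr phi1) (fun x => cst 1 x ^+ size Lr).
  apply: transports_update_on => //.
  - by rewrite filter_uniq// enum_uniq.
  - move=> j jl; apply: transports_shift.
      apply: measurable_funN; apply: measurable_funM => //.
      exact: measurable_column_product.
    move=> x t; apply: gE => i il; rewrite tnth_set_coord ifN//.
    by apply: contra il => /eqP ->.
  - move=> j x y jl xy; rewrite /phi1 (gE j x y) ?xy ?eqxx ?orbT// => i il.
    by apply: xy; rewrite il.
have T2 : transports (update_on Lc phi2) (fun x => `|s x| ^+ size Lc).
  apply: transports_update_on => //.
  - by rewrite map_inj_uniq ?uniq_column_coords//; exact: enum_rank_inj.
  - move=> j jl; apply: transports_scale => // x t; apply: sE.
    rewrite /coordinate tnth_set_coord ifN//.
    by apply: contra pLc => /eqP ->.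
  - move=> j x y jl xy; rewrite /phi2 (sE x y) /coordinate ?xy ?pLc ?eqxx ?orbT//.
  - by move=> x y xy; rewrite (sE x y)// /coordinate xy.
have T := transports_comp (transports_comp T1 T2) (transports_oppV R (enum_rank (inl p))).
set J := (X in transports _ X) in T.
have U1 x : tnth (update_on Lr phi1 x) (enum_rank (inl p)) = tnth x (enum_rank (inl p)).
  by rewrite tnth_mktuple (negbTE pLr).
have U2 x : tnth (update_on Lc phi2 x) (enum_rank (inl p)) = tnth x (enum_rank (inl p)).
  by rewrite tnth_mktuple (negbTE pLc).
have JE : J = (fun x => `|inverse_pivot p x| ^+ (m.-1 * beta k + 2)).
  apply/funext => x; rewrite /J /= U2 U1 expr1n mulr1 size_map size_column_coords.
  rewrite (sE _ x) ?/coordinate ?U1// exprD mulrC /s /inverse_pivot /coordinate.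
  case: eqP => [->|_]; first by rewrite invr0 normr0 !expr0n /= !mulr0.
  by congr (_ * _); rewrite -[in RHS]normrX ger0_norm// sqr_ge0.
rewrite JE in T; apply: (transports_eq T) => [|x].
  exact: measurable_sweep_coords.
move=> Jx; have p0 : coordinate x (inl p) != 0.
  apply: contra Jx => /eqP p0.
  by rewrite /inverse_pivot p0 invr0 normr0 addn2 expr0n.
have sx : s x = inverse_pivot p x by rewrite /s (negbTE p0).
apply: coordinate_inj => c; rewrite coordinate_coords /coordinate.
have xc : coord_of (mat x) c = tnth x (enum_rank c).
  by rewrite -coordinate_coords coords_matK.
rewrite /= tnth_set_coord (inj_eq enum_rank_inj).
have [->|cp] := eqVneq c (inl p).
  by rewrite coord_of_sweep_pivot pivot_mat U2 U1.
rewrite tnth_mktuple LcE; case: ifPn => cl.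
  rewrite coord_of_sweep_column// pivot_mat xc /phi2 (sE _ x) ?/coordinate ?U1// sx.
  by rewrite tnth_mktuple LrE cl andbF.
rewrite coord_of_sweep_rest// pivot_mat xc tnth_mktuple LrE cp cl /=.
by rewrite /phi1 /g sx enum_rankK.
Qed.

End SweepTransport.

(** * Inversion on the cone *)

Section ConeInversion.
Variables (R : realType) (k : algebra_kind) (m : nat).
Local Notation A := (alg R k).
Local Notation RT := (measurableTypeR R).
Local Notation N := (hdim k m).
Local Notation coordT := (N.-tuple RT).
Implicit Types (S : 'M[A]_m) (p i j : 'I_m) (x y : coordT) (l : seq 'I_m).
Local Notation mat := (@herm_of_tuple R k m).
Local Notation q := (m.-1 * beta k + 2)%N.

Lemma transports_sweeps l :
  transports (fun x => coords (sweeps l (mat x)))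
             (fun x => \prod_(r <- pivots l (mat x)) `|r^-1| ^+ q).
Proof.
elim: l => [|p l IH] /=.
  apply: (transports_eq (Phi := id) (Psi := fun x => coords (mat x))).
  - rewrite (_ : (fun x => _) = cst 1); first exact: transports_id.
    by apply/funext => x; rewrite big_nil.
  - rewrite (_ : (fun x => _) = id); first exact: measurable_id.
    by apply/funext => x; rewrite coords_matK.
  - by move=> x _; rewrite coords_matK.
have := transports_comp (@transports_sweep R k m p) IH.
rewrite (_ : _ \o _ = fun x => coords (sweeps l (sweep p (mat x)))); last first.
  by apply/funext => x /=; rewrite mat_sweep_coords.
congr transports; apply/funext => x; rewrite mat_sweep_coords big_cons mulrC.
by rewrite pivot_mat.
Qed.

Lemma transports_opp :
  transports (fun x => [tuple - tnth x c | c < N] : coordT) (cst 1).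
Proof.
have T : transports (update_on (enum 'I_N) (fun (c : 'I_N) x => tnth x c * (-1)))
    (fun x => `|-1| ^+ size (enum 'I_N)).
  apply: transports_update_on; first exact: enum_uniq.
  - move=> i _; apply: (@transports_scale _ _ i (cst (-1))) => // x.
    by rewrite oppr_eq0 oner_eq0.
  - by move=> i x y _ xy; rewrite xy// eqxx orbT.
  - by [].
rewrite (_ : (fun x => _) = update_on (enum 'I_N) (fun (c : 'I_N) x => tnth x c * (-1))).
  by move: T; congr transports; apply/funext => x; rewrite normrN1 expr1n.
apply/funext => x; apply/eq_from_tnth => i; rewrite !tnth_mktuple.
by rewrite mem_enum mulrN1.
Qed.

(** On the cone these are the coordinates of the inverse matrix; the formula
    by sweeps is defined, and measurable, for all hermitian matrices. *)
Definition inversion x : coordT := coords (- sweeps (enum 'I_m) (mat x)).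

Definition inversion_jacobian x : R :=
  \prod_(r <- pivots (enum 'I_m) (mat x)) `|r^-1| ^+ q.

Lemma transports_inversion : transports inversion inversion_jacobian.
Proof.
have := transports_comp (transports_sweeps (enum 'I_m)) transports_opp.
congr transports; last by apply/funext => x; rewrite mul1r.
apply/funext => x; apply/eq_from_tnth => i /=; rewrite !tnth_mktuple.
by case: (enum_val i) => [h|[u h]] /=; rewrite mxE ?reAN ?componentN.
Qed.

Lemma coneP x : posdef (mat x) <-> all (>%R^~ 0) (pivots (enum 'I_m) (mat x)).
Proof. by apply: posdef_pivots; exact: hermitian_mat. Qed.

(** Positive definiteness is a condition on all vectors; the pivots replace
    it by finitely many inequalities between measurable functions. *)
Lemma measurable_cone : measurable (@cone R k m).
Proof.
have -> : @cone R k m = [set x | all (>%R^~ 0) (pivots (enum 'I_m) (mat x))].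
  by apply/funext => x; apply/propext; exact: coneP.
elim: (enum 'I_m) => [|p l IH] /=.
  by rewrite (_ : [set _ | _] = setT)//; apply/funext => x; apply/propext.
rewrite (_ : [set _ | _] = [set x | 0 < coordinate x (inl p)] `&`
  (@sweep_coords R k m p @^-1` [set x | all (>%R^~ 0) (pivots l (mat x))])).
  apply: measurableI.
    rewrite -[X in measurable X]setTI.
    rewrite (_ : [set _ | _] = (fun x => coordinate x (inl p)) @^-1` `]0, +oo[%classic).
      exact: (measurable_coordinate (inl p)).
    by apply/seteqP; split => x /=; rewrite in_itv/= andbT.
  by rewrite -[X in measurable X]setTI; apply: measurable_sweep_coords.
apply/seteqP; split => x /=; rewrite mat_sweep_coords pivot_mat.
  by move=> /andP.
by move=> [-> ->].
Qed.

Lemma cone_inversionE x : cone x -> inversion x = coords (hinv (mat x)).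
Proof.
move=> px; rewrite hinv_sweeps//; first exact: hermitian_mat.
exact: pivots_neq0.
Qed.

Lemma mat_inversion x : cone x -> mat (inversion x) = hinv (mat x).
Proof.
by move=> px; rewrite cone_inversionE// mat_coordsK//; case: (posdef_hinv px).
Qed.

Lemma cone_inversion x : cone x -> cone (inversion x).
Proof. by move=> px; rewrite /cone /= mat_inversion//; exact: posdef_hinv. Qed.

Lemma inversionK x : cone x -> inversion (inversion x) = x.
Proof.
move=> px; rewrite cone_inversionE; last exact: cone_inversion.
by rewrite mat_inversion// hinvK// coords_matK.
Qed.

Lemma inversion_jacobianE x : cone x ->
  inversion_jacobian x = (hdet (mat x))^-1 ^+ q.
Proof.
move=> px; rewrite hdet_pivots// /inversion_jacobian prodrXl; congr (_ ^+ _).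
rewrite -prodfV big_seq [RHS]big_seq; apply: eq_bigr => r rp.
have /allP/(_ r rp) r0 := (coneP x).1 px.
by rewrite ger0_norm// invr_ge0 ltW.
Qed.

(** A nonzero Jacobian means nonzero pivots, and then inversion x is an
    actual inverse of the matrix, whose positivity can be transferred back. *)
Lemma cone_of_inversion x : inversion_jacobian x != 0 -> cone (inversion x) -> cone x.
Proof.
move=> J0 pi; have hS := hermitian_mat x.
have pS : all (fun r => r != 0) (pivots (enum 'I_m) (mat x)).
  apply/allP => r rp; apply: contra J0 => /eqP r0.
  rewrite /inversion_jacobian prodf_seq_eq0; apply/hasP; exists r => //=.
  by rewrite r0 invr0 normr0 addn2 expr0n.
have hT : Defs.hermitian (- sweeps (enum 'I_m) (mat x)).
  by rewrite /Defs.hermitian ctrmxN hermitian_sweeps.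
have [ST TS] := sweeps_enum hS pS.
move: pi; rewrite /cone /= /inversion mat_coordsK// => pi.
exact: posdef_inverse pi TS hS.
Qed.

(** The formula of transports_inversion for f restricted to the left-hand
    domain. The restrictions match because inversion is an involution of the
    cone and, off the cone, either the Jacobian vanishes or the image is off
    the cone as well. *)
Lemma integral_cone_inversion (f : coordT -> R) (B : set coordT) :
  measurable B -> measurable_fun (@cone R k m) f -> (forall x, cone x -> 0 <= f x) ->
  (\int[lebesgueN R N]_(x in @cone R k m `&` (inversion @^-1` B)) (f x)%:E =
   \int[lebesgueN R N]_(x in @cone R k m `&` B)
      (f (inversion x) * inversion_jacobian x)%:E)%E.
Proof.
move=> mB mf f0; have [mi mJ J0 iJ] := transports_inversion.
have mC := measurable_cone.
have mD : measurable (@cone R k m `&` (inversion @^-1` B)).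
  by apply: measurableI => //; rewrite -[X in measurable X]setTI; exact: mi.
rewrite integral_mkcond [RHS]integral_mkcond -iJ.
- apply: eq_integral => x _; rewrite !patchE.
  have [Jx|Jx] := eqVneq (inversion_jacobian x) 0.
    by rewrite Jx mulr0 mule0; case: ifP.
  have E : (inversion x \in @cone R k m `&` (inversion @^-1` B)) =
           (x \in @cone R k m `&` B).
    apply/idP/idP; rewrite !inE /= => -[px Bx]; split.
    + exact: cone_of_inversion.
    + by rewrite inversionK// in Bx; exact: cone_of_inversion.
    + exact: cone_inversion.
    + by rewrite inversionK.
  by rewrite E; case: ifP; rewrite ?mul0e.
- apply/(measurable_restrictT _ mD)/measurable_EFinP.
  by apply: measurable_funS mf => //; exact: subIsetl.
- by move=> x; apply: erestrict_ge0 => y [py _]; rewrite lee_fin f0.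
Qed.

Section Density.
Variables (d : measure_display) (T : measurableType d) (P : probability T R).
Local Notation C := (R[i])%C.

(** The event that the inverse lies in B is the event that X lies in the
    preimage of B under inversion. *)
Lemma has_density_hinv (X : T -> 'M[A]_m) (f g : 'M[A]_m -> C) :
  (forall w, posdef (X w)) ->
  (forall S, posdef S -> g S = f (hinv S) * (((hdet S)^-1 ^+ q)%:C)%C) ->
  has_density P X f -> has_density P (fun w => hinv (X w)) g.
Proof.
move=> pX gE [mX f0 mf Pf]; have [mi mJ J0 _] := transports_inversion.
have YE w : coords (hinv (X w)) = inversion (coords (X w)).
  by rewrite cone_inversionE /cone /= mat_coordsK//; case: (pX w).
have gRe x : cone x -> complex.Re (g (mat x)) =
    complex.Re (f (mat (inversion x))) * inversion_jacobian x.
  move=> px; rewrite gE// mat_inversion// inversion_jacobianE//.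
  by case: (f _) => a b /=; rewrite mulr0 subr0.
split.
- under eq_fun do rewrite YE.
  exact: measurableT_comp.
- move=> S pS; rewrite gE// mulr_ge0 ?f0//; first exact: posdef_hinv.
  by rewrite ler0c exprn_ge0// invr_ge0 ltW//; have [] := hdet_posdef pS.
- apply: (@eq_measurable_fun _ _ _ _ _ (fun x =>
    complex.Re (f (mat (inversion x))) * inversion_jacobian x)).
    by move=> x; rewrite inE => /gRe.
  apply: measurable_funM; last exact: measurable_funTS.
  apply: (measurable_comp measurable_cone _ mf); last exact: measurable_funTS.
  by move=> _ [x px <-]; exact: cone_inversion.
- move=> B mB.
  rewrite (_ : [set w | B (coords (hinv (X w)))] =
      [set w | (inversion @^-1` B) (coords (X w))]); last first.
    by apply/funext => w; rewrite /= YE.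
  rewrite Pf; last by rewrite -[X in measurable X]setTI; exact: mi.
  rewrite (integral_cone_inversion mB mf) => [|x px]; last first.
    by have := f0 _ px; rewrite lecE => /andP[].
  by apply: eq_integral => x; rewrite inE => -[px _]; rewrite gRe.
Qed.

End Density.
End ConeInversion.

(** * The Riesz densities *)

Section ComplexPower.
Variable R : realType.
Local Notation C := (R[i])%C.

Lemma cexpD_real (z : C) (r : R) : cexp (z + r%:C%C) = cexp z * ((expR r)%:C)%C.
Proof.
case: z => u v; rewrite /cexp /= addr0 expRD.
by congr Complex; ring.
Qed.

(** Replacing x by its inverse changes the sign of the exponent; multiplying
    by x^-(2 s + 2), which is the Jacobian of inversion when s = (m - 1)
    beta / 2, turns a - s - 1 into - (a + s + 1). *)
Lemma cpowV (x s : R) (a : C) (q : nat) : 0 < x -> 2 * s + 2 = q%:R ->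
  cpow x (- (a + s%:C%C + 1)) = cpow x^-1 (a - s%:C%C - 1) * ((x^-1 ^+ q)%:C)%C.
Proof.
move=> x0 sq; have -> : x^-1 ^+ q = expR (- (q%:R * ln x)).
  by rewrite expRN expRM_natl lnK ?posrE// exprVn.
rewrite /cpow -cexpD_real; congr cexp; rewrite lnV ?posrE// -sq.
by case: a => u v; congr Complex => /=; ring.
Qed.

End ComplexPower.

Section Densities.
Variables (R : realType) (k : algebra_kind) (n : nat).
Variables (a : (R[i])%C) (kap : 'I_n.+1 -> R) (Sigma : 'rV[(R[i])%C]_(hdim k n.+1)).
Local Notation q := (n.+1.-1 * beta k + 2)%N.

Lemma half_shiftE : 2 * half_shift R k n + 2 = q%:R.
Proof. by rewrite /half_shift natrD natrM /=; field. Qed.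

Lemma inv_riesz1_densityE (S : 'M[alg R k]_n.+1) : posdef S ->
  inv_riesz1_density a kap Sigma S =
  riesz1_density a kap Sigma (hinv S) * (((hdet S)^-1 ^+ q)%:C)%C.
Proof.
move=> pS; have [d0 _] := hdet_posdef pS.
rewrite /inv_riesz1_density /riesz1_density (cpowV a d0 half_shiftE) hdet_hinv//.
by rewrite mulrA mulrAC.
Qed.

Lemma inv_riesz2_densityE (S : 'M[alg R k]_n.+1) : posdef S ->
  inv_riesz2_density a kap Sigma S =
  riesz2_density a kap Sigma (hinv S) * (((hdet S)^-1 ^+ q)%:C)%C.
Proof.
move=> pS; have [d0 _] := hdet_posdef pS.
rewrite /inv_riesz2_density /riesz2_density (cpowV a d0 half_shiftE) hdet_hinv//.
by rewrite hinvK// mulrA mulrAC.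
Qed.

End Densities.

Theorem theorem3p1 (R : realType) (k : algebra_kind) (n : nat)
    (Sigma : 'rV[R[i]]_(hdim k n.+1)) (kap : 'I_n.+1 -> R) (a : R[i])
    (d : measure_display) (T : measurableType d) (P : probability T R)
    (X Y : T -> 'M[alg R k]_n.+1) :
  half_plane Sigma ->
  (forall w, posdef (X w)) ->
  (forall w, Y w = hinv (X w)) ->
  (n%:R * (beta k)%:R / 2 - kap ord_max <= complex.Re a ->
   has_density P X (riesz1_density a kap Sigma) ->
   has_density P Y (inv_riesz1_density a kap Sigma)) /\
  (n%:R * (beta k)%:R / 2 + kap ord0 < complex.Re a ->
   has_density P X (riesz2_density a kap Sigma) ->
   has_density P Y (inv_riesz2_density a kap Sigma)).
Proof.
move=> _ pX YX; have -> : Y = fun w => hinv (X w) by exact/funext.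
split=> _; apply: has_density_hinv => // S.
  exact: inv_riesz1_densityE.
exact: inv_riesz2_densityE.
Qed.
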